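(* Let $R$ be a commutative Noetherian ring and let $\mathcal{A}$ be an aisle in $D_{\mathrm{qc}}(R)$. Let $n\in\mathbb{Z}$, let $p'\in\phi(\mathcal{A})(n)$, and let $p$ be a prime of $R$ maximal under $p'$. Then $p\in\phi(\mathcal{A})(n+1)$.
   Context: $D(R)$ is the unbounded derived category of $R$-modules; complexes are graded homologically (differential of degree $-1$), and $s$ is the suspension, $H_i(sM)=H_{i-1}(M)$. $D_{\mathrm{qc}}(R)\subset D(R)$ is the full triangulated subcategory of objects $M$ such that every $H_i(M)$ is finitely generated and $H_i(M)=0$ for all but finitely many $i$. A full subcategory $\mathcal{U}$ of a triangulated category $\mathbf{T}$ is a pre-aisle if $X\in\mathcal{U}$ implies $sX\in\mathcal{U}$, and for every distinguished triangle $X\to Y\to Z\to sX$ with $X,Z\in\mathcal{U}$ one has $Y\in\mathcal{U}$. A pre-aisle is an aisle in $\mathbf{T}$ if the inclusion $\mathcal{U}\subset\mathbf{T}$ has a right adjoint (equivalently, $(\mathcal{U},s\,\mathcal{U}^{\perp})$ is a t-structure). For an $R$-module $B$, $\operatorname{Ass}B$ is the set of associated primes; for $U\subset\operatorname{Spec}R$, $\overline{U}=\{p : \exists q\in U,\ q\subset p\}$. For $\mathcal{A}\subset D_{\mathrm{qc}}(R)$, $$\phi(\mathcal{A})(n)=\{p\in\operatorname{Spec}R : \exists M\in\mathcal{A}\text{ with }p\in\overline{\operatorname{Ass}H_n(M)}\}.$$ A prime $p$ is maximal under $p'$ if $p\subsetneq p'$ and there is no prime strictly between $p$ and $p'$.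 *)

(* Defs.v *)
From HB Require Import structures.
From mathcomp Require Import all_boot all_order all_algebra.
From mathcomp Require Import mathcomp_extra boolp classical_sets functions cardinality.

Set Implicit Arguments.
Unset Strict Implicit.
Unset Printing Implicit Defensive.

Import GRing.Theory.
Local Open Scope ring_scope.
Local Open Scope quotient_scope.
Local Open Scope classical_set_scope.

(** * Commutative algebra *)

(* Rings are [comPzRingType], so that the zero ring is allowed.  A submodule of
   the regular module [R^o] is an ideal. *)
Definition noetherian (R : comPzRingType) : Prop :=
  forall I : {pred R^o}, submod_closed I ->
    exists (m : nat) (g : 'I_m -> R),
      forall x : R, x \in I <-> exists c : 'I_m -> R, x = \sum_i c i * g i.

Record Spec (R : comPzRingType) := MkSpec {
  spec_mem : R -> bool;
  spec_ideal : submod_closed (spec_mem : {pred R^o});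
  spec_proper : ~~ spec_mem 1;
  spec_prime : forall u v : R, spec_mem (u * v) -> spec_mem u || spec_mem v
}.

Definition pred_of_spec (R : comPzRingType) (p : Spec R) : {pred R} :=
  spec_mem p.
Coercion pred_of_spec : Spec >-> pred_sort.

Definition maximal_under (R : comPzRingType) (p p' : Spec R) : Prop :=
  [/\ {subset p <= p'}, ~ {subset p' <= p} &
      ~ exists q : Spec R, [/\ {subset p <= q}, ~ {subset q <= p},
                              {subset q <= p'} & ~ {subset p' <= q}]].

Definition Ass (R : comPzRingType) (B : lmodType R) (p : Spec R) : Prop :=
  exists b : B, forall r : R, (r \in p) = (r *: b == 0).

Definition spec_closure (R : comPzRingType) (U : Spec R -> Prop) (p : Spec R) :
  Prop := exists2 q, U q & {subset q <= p}.

Definition finitely_generated (R : comPzRingType) (B : lmodType R) : Prop :=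
  exists (m : nat) (g : 'I_m -> B),
    forall b : B, exists c : 'I_m -> R, b = \sum_i c i *: g i.

Section QuotientModule.
Variables (R : pzRingType) (V : lmodType R) (S : submodClosed V).

Fact submodClosed_zmod_closed : zmod_closed S.
Proof. exact/GRing.submod_closedB/submodClosedP. Qed.

(* [submodClosed] does not inherit from [zmodClosed], which [Quotient] needs. *)
Definition submod_zmodClosed : zmodClosed V :=
  HB.pack_for (zmodClosed V) (GRing.SubmodClosed.sort S)
    (GRing.isZmodClosed.Build V (GRing.SubmodClosed.sort S) submodClosed_zmod_closed).

Definition quotmod := Quotient.quot submod_zmodClosed.
HB.instance Definition _ := GRing.Zmodule.on quotmod.
HB.instance Definition _ := Quotient.on quotmod.

Definition quotmod_scale (a : R) (x : quotmod) : quotmod :=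
  \pi_quotmod (a *: repr x).

Lemma quotmod_eq (x y : V) :
  (\pi_quotmod x == \pi_quotmod y) = (x - y \in S).
Proof. by rewrite -Quotient.idealrBE. Qed.

Lemma quotmod_scaleE a x :
  quotmod_scale a (\pi_quotmod x) = \pi_quotmod (a *: x).
Proof.
apply/eqP; rewrite quotmod_eq -scalerBr rpredZ //.
by rewrite -quotmod_eq reprK.
Qed.

Lemma quotmod_piD (x y : V) :
  \pi_quotmod x + \pi_quotmod y = \pi_quotmod (x + y).
Proof. exact: esym (@Quotient.pi_add V submod_zmodClosed x y). Qed.

Fact quotmod_scaleA a b x :
  quotmod_scale a (quotmod_scale b x) = quotmod_scale (a * b) x.
Proof. by elim/quotW: x => x; rewrite (quotmod_scaleE b) !quotmod_scaleE scalerA. Qed.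

Fact quotmod_scale1 : left_id 1 quotmod_scale.
Proof. by elim/quotW=> x; rewrite quotmod_scaleE scale1r. Qed.

Fact quotmod_scaleDr : right_distributive quotmod_scale +%R.
Proof.
move=> a; elim/quotW=> x; elim/quotW=> y; rewrite quotmod_piD !quotmod_scaleE.
by rewrite quotmod_piD scalerDr.
Qed.

Fact quotmod_scaleDl x : {morph quotmod_scale^~ x : a b / a + b}.
Proof.
move=> a b; elim/quotW: x => x; rewrite !quotmod_scaleE.
by rewrite quotmod_piD scalerDl.
Qed.

HB.instance Definition _ := GRing.Zmodule_isLmodule.Build R quotmod
  quotmod_scaleA quotmod_scale1 quotmod_scaleDr quotmod_scaleDl.

End QuotientModule.

(** * Complexes, homology, quasi-isomorphisms *)

Record complex (R : comPzRingType) := MkComplex {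
  cobj :> int -> lmodType R;
  cdiff : forall i : int, {linear cobj i -> cobj (i - 1)};
  cdiffK : forall (i : int) (x : cobj i), cdiff (i - 1) (cdiff i x) = 0
}.
Arguments cdiff {R} c i.

(* [boundary x], for [x : M j], says that [x] is in the image of the
   differential with target [M j]; the inductive type avoids a transport along
   [(j + 1) - 1 = j]. *)
Inductive boundary (R : comPzRingType) (M : complex R) :
    forall i : int, M i -> Prop :=
  Boundary (i : int) (x : M i) : boundary (cdiff M i x).

Lemma boundaryP (R : comPzRingType) (M : complex R) (i : int) (x : M i) :
  boundary x <-> exists (j : int) (e : j - 1 = i) (y : M j),
    x = ecast k (M k) e (cdiff M j y).
Proof.
split=> [|[j [e [y ->{x}]]]]; last by case: i / e.
by case: x / => j y; exists j, erefl, y.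
Qed.

Lemma boundary0 (R : comPzRingType) (M : complex R) (i : int) : boundary (0 : M i).
Proof.
have: exists j : int, j - 1 = i by exists (i + 1); rewrite addrK.
by move=> [j e]; case: i / e; rewrite -(linear0 (cdiff M j)).
Qed.

Lemma boundary_linear (R : comPzRingType) (M : complex R) (i : int) (a : R)
    (u v : M i) :
  boundary u -> boundary v -> boundary (a *: u + v).
Proof.
move=> /boundaryP[j [e [x ->]]] /boundaryP[k [e' [y ->]]].
have ejk : j = k by apply: (@addIr _ (- 1)); rewrite e e'.
case: k / ejk y e' => y e'; rewrite (eq_irrelevance e' e) {e'}.
by case: i / e u v => _ _; rewrite -linearP.
Qed.

Section Homology.
Variables (R : comPzRingType) (M : complex R) (i : int).

Definition cycle_pred : {pred M i} := [pred x | cdiff M i x == 0].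

Fact cycle_submod_closed : submod_closed cycle_pred.
Proof.
split=> [|a u v]; rewrite !inE ?linear0 // => /eqP u0 /eqP v0.
by rewrite linearP /= u0 v0 scaler0 addr0.
Qed.
HB.instance Definition _ :=
  GRing.isSubmodClosed.Build R (M i) cycle_pred cycle_submod_closed.

Record cycle := MkCycle { cycle_val : M i; _ : cycle_val \in cycle_pred }.
HB.instance Definition _ := [isSub for cycle_val].

Lemma cycle_eq0 (z : cycle) : cdiff M i (cycle_val z) = 0.
Proof. by case: z => z zc; apply/eqP. Qed.

HB.instance Definition _ := [Choice of cycle by <:].
HB.instance Definition _ := [SubChoice_isSubLmodule of cycle by <:].

Definition cycle_boundary : {pred cycle} :=
  [pred z | `[< boundary (cycle_val z) >]].

Fact boundary_submod_closed : submod_closed cycle_boundary.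
Proof.
split=> [|a u v]; first by apply/asboolP; exact: boundary0.
by move=> /asboolP bu /asboolP bv; apply/asboolP; exact: boundary_linear.
Qed.
HB.instance Definition _ :=
  GRing.isSubmodClosed.Build R cycle cycle_boundary boundary_submod_closed.

Definition homology : lmodType R := quotmod cycle_boundary.

Definition homology_class (z : cycle) : homology :=
  \pi_(quotmod cycle_boundary) z.

Lemma homology_class_surj (h : homology) : exists z, h = homology_class z.
Proof.
by exists (repr (h : quotmod cycle_boundary)); rewrite /homology_class reprK.
Qed.

Fact homology_class_linear : linear homology_class.
Proof.
move=> a u v; rewrite /homology_class -quotmod_piD; congr (_ + _).
exact: esym (@quotmod_scaleE _ _ (cycle_boundary : submodClosed cycle) a u).
Qed.
HB.instance Definition _ := GRing.isLinear.Build R cycle homology _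
  homology_class homology_class_linear.

End Homology.

Record chain_map (R : comPzRingType) (M N : complex R) := MkChainMap {
  cmap :> forall i : int, {linear M i -> N i};
  cmapP : forall (i : int) (x : M i),
    cmap (i - 1) (cdiff M i x) = cdiff N i (cmap i x)
}.

Section HomologyMap.
Variables (R : comPzRingType) (M N : complex R) (f : chain_map M N) (i : int).

Fact cycle_map_subproof (z : cycle M i) : f i (cycle_val z) \in @cycle_pred R N i.
Proof. by case: z => x /= /eqP dx; rewrite inE -cmapP dx linear0. Qed.

Definition cycle_map (z : cycle M i) : cycle N i :=
  MkCycle (cycle_map_subproof z).

Definition homology_map (h : homology M i) : homology N i :=
  homology_class (cycle_map (repr (h : quotmod (@cycle_boundary R M i)))).

End HomologyMap.

Lemma boundary_map (R : comPzRingType) (M N : complex R) (f : chain_map M N)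
    (i : int) (x : M i) : boundary x -> boundary (f i x).
Proof. by case=> j y; rewrite cmapP. Qed.

Lemma homology_eq (R : comPzRingType) (M : complex R) (i : int)
    (z t : cycle M i) :
  homology_class z = homology_class t <->
  boundary (cycle_val z - cycle_val t).
Proof.
have valB : cycle_val (z - t) = cycle_val z - cycle_val t.
  exact: (raddfB (val : cycle M i -> M i)).
rewrite -valB; split=> [/eqP|b]; first by rewrite quotmod_eq inE.
by apply/eqP; rewrite quotmod_eq inE.
Qed.

Lemma homology_mapE (R : comPzRingType) (M N : complex R) (f : chain_map M N)
    (i : int) (z : cycle M i) :
  homology_map f (homology_class z) = homology_class (cycle_map f z).
Proof.
apply/homology_eq; rewrite /= -linearB; apply: boundary_map.
by apply/homology_eq; rewrite /homology_class reprK.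
Qed.

Definition quasi_iso (R : comPzRingType) (M N : complex R)
    (f : chain_map M N) : Prop :=
  forall i : int, bijective (@homology_map R M N f i).

Lemma quasi_isoP (R : comPzRingType) (M N : complex R) (f : chain_map M N) :
  quasi_iso f <-> forall i : int,
    (forall x : M i, cdiff M i x = 0 -> boundary (f i x) -> boundary x) /\
    (forall y : N i, cdiff N i y = 0 ->
       exists2 x : M i, cdiff M i x = 0 & boundary (f i x - y)).
Proof.
have cyc (X : complex R) i (x : X i) : cdiff X i x = 0 -> x \in @cycle_pred R X i.
  by move=> /eqP.
split=> [fq i|fq i].
  have finj := bij_inj (fq i); case: (fq i) => g _ gK.
  split=> [x dx bfx|y dy].
    have b0 : boundary (x - 0) -> boundary x by rewrite subr0.
    have c0 : cdiff M i 0 = 0 by rewrite linear0.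
    apply: b0; apply/(@homology_eq R M i (MkCycle (cyc _ _ _ dx))
                        (MkCycle (cyc _ _ _ c0))).
    by apply: finj; rewrite !homology_mapE; apply/homology_eq; rewrite /= linear0 subr0.
  have [z zE] := homology_class_surj (g (homology_class (MkCycle (cyc _ _ _ dy)))).
  exists (cycle_val z); first exact: cycle_eq0.
  by move: (gK (homology_class (MkCycle (cyc _ _ _ dy)))); rewrite zE homology_mapE => /homology_eq.
have [f1 f2] := fq i; rewrite -setTT_bijective; split=> //.
- move=> h k _ _; have [z ->] := homology_class_surj h.
  have [t ->] := homology_class_surj k.
  rewrite !homology_mapE => /homology_eq /= b; apply/homology_eq.
  apply: f1; last by rewrite linearB.
  by rewrite linearB /= !cycle_eq0 subrr.
- move=> k _; have [[y yc] ->] := homology_class_surj k.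
  have [x dx b] := f2 y (eqP yc).
  by exists (homology_class (MkCycle (cyc _ _ _ dx))) => //; rewrite homology_mapE; apply/homology_eq.
Qed.

Definition chain_id (R : comPzRingType) (M : complex R) : chain_map M M :=
  @MkChainMap R M M (fun i => idfun) (fun i x => erefl).

Section ChainComp.
Variables (R : comPzRingType) (L M N : complex R).
Variables (g : chain_map M N) (f : chain_map L M).

Fact chain_comp_subproof (i : int) (x : L i) :
  (g (i - 1) \o f (i - 1)) (cdiff L i x) = cdiff N i ((g i \o f i) x).
Proof. by rewrite /= !cmapP. Qed.

Definition chain_comp : chain_map L N :=
  @MkChainMap R L N (fun i => g i \o f i) chain_comp_subproof.

End ChainComp.

(** * Suspension and mapping cones *)

Section Suspension.
Variable R : comPzRingType.

Fact susp_diffK (M : complex R) (i : int) (x : M (i - 1)) :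
  (\- cdiff M (i - 1 - 1)) ((\- cdiff M (i - 1)) x) = 0.
Proof. by rewrite /= linearN opprK cdiffK. Qed.

Definition susp (M : complex R) : complex R :=
  @MkComplex R (fun i => M (i - 1)) (fun i => \- cdiff M (i - 1))
    (@susp_diffK M).

Fact susp_map_subproof (M N : complex R) (f : chain_map M N) (i : int)
    (x : susp M i) :
  f (i - 1 - 1) (cdiff (susp M) i x) = cdiff (susp N) i (f (i - 1) x).
Proof. by rewrite /= linearN cmapP. Qed.

Definition susp_map (M N : complex R) (f : chain_map M N) :
    chain_map (susp M) (susp N) :=
  @MkChainMap R (susp M) (susp N) (fun i => f (i - 1)) (susp_map_subproof f).

End Suspension.

Section Cone.
Variables (R : comPzRingType) (X Y : complex R) (f : chain_map X Y).

Definition cone_obj (i : int) : lmodType R := (Y i * X (i - 1))%type.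

Definition cone_diff_fun (i : int) (z : cone_obj i) : cone_obj (i - 1) :=
  (cdiff Y i z.1 + f (i - 1) z.2, - cdiff X (i - 1) z.2).

Fact cone_diff_linear i : linear (@cone_diff_fun i).
Proof.
move=> a u v; rewrite /cone_diff_fun /= !linearP /=; congr pair.
by rewrite addrACA -scalerDr.
Qed.
HB.instance Definition _ i := GRing.isLinear.Build R (cone_obj i)
  (cone_obj (i - 1)) _ (@cone_diff_fun i) (@cone_diff_linear i).

Fact cone_diffK i (z : cone_obj i) : cone_diff_fun (cone_diff_fun z) = 0.
Proof.
rewrite /cone_diff_fun /= linearD linearN /= !cdiffK add0r cmapP linearN subrr.
by rewrite cdiffK !oppr0.
Qed.

Definition cone : complex R :=
  @MkComplex R cone_obj (fun i => @cone_diff_fun i) cone_diffK.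

End Cone.

Lemma boundary_susp (R : comPzRingType) (M : complex R) (i : int)
    (x : M (i - 1)) : @boundary R (susp M) i x <-> @boundary R M (i - 1) x.
Proof.
split=> [b|/boundaryP[j [e [y ->]]]].
  by case: b => j y; rewrite /= -linearN.
have [k ek] : exists k : int, k - 1 = j by exists (j + 1); rewrite addrK.
case: j / ek e y => e y; have ei := addIr _ e.
case: i / ei x e => x e; rewrite (eq_irrelevance e erefl) /=.
have -> : cdiff M _ y = cdiff (susp M) k (- y) by rewrite /= linearN opprK.
exact: Boundary.
Qed.

Lemma quasi_iso_susp (R : comPzRingType) (M N : complex R)
    (f : chain_map M N) : quasi_iso f -> quasi_iso (susp_map f).
Proof.
move=> /quasi_isoP fq; apply/quasi_isoP => i; have [f1 f2] := fq (i - 1).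
split=> [x /eqP|y /eqP]; rewrite /= oppr_eq0 => /eqP dx.
  by move=> /boundary_susp b; apply/boundary_susp; apply: f1.
have [x dx' b] := f2 y dx; exists x; first by rewrite dx' oppr0.
exact/boundary_susp.
Qed.

Section ConeTriangle.
Variables (R : comPzRingType) (X Y : complex R) (f : chain_map X Y).

Definition cone_in_fun (i : int) (y : Y i) : cone f i := (y, 0).

Fact cone_in_linear i : linear (@cone_in_fun i).
Proof. by move=> a u v; congr pair; rewrite /= scaler0 addr0. Qed.
HB.instance Definition _ i :=
  GRing.isLinear.Build R (Y i) (cone f i) _ (@cone_in_fun i) (@cone_in_linear i).

Fact cone_in_subproof (i : int) (y : Y i) :
  cone_in_fun (cdiff Y i y) = cdiff (cone f) i (cone_in_fun y).
Proof. by rewrite /= /cone_diff_fun /= !linear0 addr0. Qed.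

Definition cone_in : chain_map Y (cone f) :=
  @MkChainMap R Y (cone f) (fun i => @cone_in_fun i) cone_in_subproof.

Definition cone_out_fun (i : int) (z : cone f i) : susp X i := z.2.

Fact cone_out_linear i : linear (@cone_out_fun i).
Proof. by []. Qed.
HB.instance Definition _ i := GRing.isLinear.Build R (cone f i) (susp X i) _
  (@cone_out_fun i) (@cone_out_linear i).

Fact cone_out_subproof (i : int) (z : cone f i) :
  cone_out_fun (cdiff (cone f) i z) = cdiff (susp X) i (cone_out_fun z).
Proof. by []. Qed.

Definition cone_out : chain_map (cone f) (susp X) :=
  @MkChainMap R (cone f) (susp X) (fun i => @cone_out_fun i) cone_out_subproof.

End ConeTriangle.

(** * Categories whose morphisms are considered up to an equivalence *)

Record category := MkCategory {
  obj :> Type;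
  hom : obj -> obj -> Type;
  heq : forall X Y : obj, hom X Y -> hom X Y -> Prop;
  idm : forall X : obj, hom X X;
  comp : forall X Y Z : obj, hom Y Z -> hom X Y -> hom X Z;
  heq_refl : forall X Y (f : hom X Y), heq f f;
  heq_sym : forall X Y (f g : hom X Y), heq f g -> heq g f;
  heq_trans : forall X Y (f g h : hom X Y), heq f g -> heq g h -> heq f h;
  comp_heq : forall X Y Z (g g' : hom Y Z) (f f' : hom X Y),
    heq g g' -> heq f f' -> heq (comp g f) (comp g' f');
  comp_assoc : forall W X Y Z (h : hom Y Z) (g : hom X Y) (f : hom W X),
    heq (comp h (comp g f)) (comp (comp h g) f);
  comp_idl : forall X Y (f : hom X Y), heq (comp (idm Y) f) f;
  comp_idr : forall X Y (f : hom X Y), heq (comp f (idm X)) f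
}.
Arguments hom {c}.
Arguments heq {c X Y}.
Arguments idm {c}.
Arguments comp {c X Y Z}.

Declare Scope cat_scope.
Delimit Scope cat_scope with cat.
Local Open Scope cat_scope.
Notation "f =h g" := (heq f g) (at level 70) : cat_scope.
Notation "g \oc f" := (comp g f) (at level 50, left associativity) : cat_scope.

Record functor (C D : category) := MkFunctor {
  fobj :> C -> D;
  fmap : forall X Y : C, hom X Y -> hom (fobj X) (fobj Y);
  fmap_heq : forall (X Y : C) (f g : hom X Y), f =h g -> fmap f =h fmap g;
  fmap_id : forall X : C, fmap (idm X) =h idm (fobj X);
  fmap_comp : forall (X Y Z : C) (g : hom Y Z) (f : hom X Y),
    fmap (g \oc f) =h fmap g \oc fmap f
}.
Arguments fmap {C D} F {X Y} _ : rename.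

Record adjunction (C D : category) (F : functor C D) (G : functor D C) :=
  MkAdjunction {
  adj_to : forall (X : C) (Y : D), hom (F X) Y -> hom X (G Y);
  adj_of : forall (X : C) (Y : D), hom X (G Y) -> hom (F X) Y;
  adj_to_heq : forall X Y (u v : hom (F X) Y), u =h v -> adj_to u =h adj_to v;
  adj_of_heq : forall X Y (u v : hom X (G Y)), u =h v -> adj_of u =h adj_of v;
  adj_ofK : forall X Y (u : hom X (G Y)), adj_to (adj_of u) =h u;
  adj_toK : forall X Y (u : hom (F X) Y), adj_of (adj_to u) =h u;
  adj_natural : forall (X X' : C) (Y Y' : D) (a : hom X' X) (b : hom Y Y')
    (u : hom (F X) Y),
    adj_to (b \oc u \oc fmap F a) =h fmap G b \oc adj_to u \oc a
}.

Definition has_right_adjoint (C D : category) (F : functor C D) : Prop :=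
  exists G : functor D C, inhabited (adjunction F G).

Definition is_iso (C : category) (X Y : C) (f : hom X Y) : Prop :=
  exists g : hom Y X, g \oc f =h idm X /\ f \oc g =h idm Y.

Definition full_sub (C : category) (P : C -> Prop) : category :=
  @MkCategory {X : C | P X} (fun X Y => hom (sval X) (sval Y))
    (fun X Y => @heq C (sval X) (sval Y)) (fun X => idm (sval X))
    (fun X Y Z => @comp C (sval X) (sval Y) (sval Z))
    (fun X Y => @heq_refl C (sval X) (sval Y))
    (fun X Y => @heq_sym C (sval X) (sval Y))
    (fun X Y => @heq_trans C (sval X) (sval Y))
    (fun X Y Z => @comp_heq C (sval X) (sval Y) (sval Z))
    (fun W X Y Z => @comp_assoc C (sval W) (sval X) (sval Y) (sval Z))
    (fun X Y => @comp_idl C (sval X) (sval Y))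
    (fun X Y => @comp_idr C (sval X) (sval Y)).

Definition inclusion (C : category) (P : C -> Prop) : functor (full_sub P) C :=
  @MkFunctor (full_sub P) C (fun X => sval X) (fun X Y f => f)
    (fun X Y f g fg => fg) (fun X => heq_refl _) (fun X Y Z g f => heq_refl _).

(** * Suspensions, distinguished triangles, aisles *)

(* The data of a triangulated category; no axiom is needed to speak of aisles. *)
Record triang_data := MkTriang {
  tcat :> category;
  tsusp : functor tcat tcat;
  distinguished : forall X Y Z : tcat,
    hom X Y -> hom Y Z -> hom Z (tsusp X) -> Prop
}.
Arguments distinguished {t X Y Z}.

Definition pre_aisle (T : triang_data) (U : T -> Prop) : Prop :=
  (forall X : T, U X -> U (tsusp T X)) /\
  (forall (X Y Z : T) (f : hom X Y) (g : hom Y Z) (h : hom Z (tsusp T X)),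
     distinguished f g h -> U X -> U Z -> U Y).

Definition aisle (T : triang_data) (U : T -> Prop) : Prop :=
  pre_aisle U /\ has_right_adjoint (inclusion U).

Section FullSubTriang.
Variables (T : triang_data) (P : T -> Prop).
Hypothesis Psusp : forall X : T, P X -> P (tsusp T X).

Definition sub_susp : functor (full_sub P) (full_sub P) :=
  @MkFunctor (full_sub P) (full_sub P)
    (fun X => exist P (tsusp T (sval X)) (Psusp (svalP X)))
    (fun X Y f => fmap (tsusp T) f)
    (fun X Y f g => @fmap_heq _ _ (tsusp T) _ _ f g)
    (fun X => fmap_id (tsusp T) (sval X))
    (fun X Y Z g f => fmap_comp (tsusp T) (g : hom (sval Y) (sval Z)) f).

Definition sub_triang : triang_data :=
  @MkTriang (full_sub P) sub_susp
    (fun X Y Z f g h => @distinguished T (sval X) (sval Y) (sval Z) f g h).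

End FullSubTriang.

(** * The derived category *)

Section Derived.
Variable R : comPzRingType.

(* D(R) is the localization of the category of complexes at the
   quasi-isomorphisms, presented by generators and relations: a morphism is a
   formal composite of chain maps and of inverses of quasi-isomorphisms, and
   [dhom_eq] is the congruence generated by the relations below.  (Homotopic
   chain maps become equal, so this is also the localization of the homotopy
   category.) *)
Inductive dhom : complex R -> complex R -> Type :=
| DMap (X Y : complex R) (f : chain_map X Y) : dhom X Y
| DInv (X Y : complex R) (w : chain_map X Y) (qw : quasi_iso w) : dhom Y X
| DComp (X Y Z : complex R) (g : dhom Y Z) (f : dhom X Y) : dhom X Z.

Inductive dhom_eq : forall X Y : complex R, dhom X Y -> dhom X Y -> Prop :=
| DRefl X Y (f : dhom X Y) : dhom_eq f f
| DSym X Y (f g : dhom X Y) : dhom_eq f g -> dhom_eq g f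
| DTrans X Y (f g h : dhom X Y) : dhom_eq f g -> dhom_eq g h -> dhom_eq f h
| DCompEq X Y Z (g g' : dhom Y Z) (f f' : dhom X Y) :
    dhom_eq g g' -> dhom_eq f f' -> dhom_eq (DComp g f) (DComp g' f')
| DAssoc W X Y Z (h : dhom Y Z) (g : dhom X Y) (f : dhom W X) :
    dhom_eq (DComp h (DComp g f)) (DComp (DComp h g) f)
| DIdl X Y (f : dhom X Y) : dhom_eq (DComp (DMap (chain_id Y)) f) f
| DIdr X Y (f : dhom X Y) : dhom_eq (DComp f (DMap (chain_id X))) f
| DMapEq X Y (f g : chain_map X Y) :
    (forall (i : int) (x : X i), f i x = g i x) -> dhom_eq (DMap f) (DMap g)
| DMapComp X Y Z (g : chain_map Y Z) (f : chain_map X Y) :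
    dhom_eq (DMap (chain_comp g f)) (DComp (DMap g) (DMap f))
| DInvl X Y (w : chain_map X Y) (qw : quasi_iso w) :
    dhom_eq (DComp (DInv qw) (DMap w)) (DMap (chain_id X))
| DInvr X Y (w : chain_map X Y) (qw : quasi_iso w) :
    dhom_eq (DComp (DMap w) (DInv qw)) (DMap (chain_id Y)).

Definition derived_cat : category :=
  @MkCategory (complex R) dhom dhom_eq (fun X => DMap (chain_id X)) DComp
    DRefl DSym DTrans DCompEq DAssoc DIdl DIdr.

Fixpoint dsusp (X Y : complex R) (f : dhom X Y) : dhom (susp X) (susp Y) :=
  match f with
  | DMap _ _ f => DMap (susp_map f)
  | DInv _ _ _ qw => DInv (quasi_iso_susp qw)
  | DComp _ _ _ g f => DComp (dsusp g) (dsusp f)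
  end.

Fact dsusp_id (X : complex R) :
  dhom_eq (dsusp (DMap (chain_id X))) (DMap (chain_id (susp X))).
Proof. exact: DMapEq. Qed.

Fact dsusp_eq (X Y : complex R) (f g : dhom X Y) :
  dhom_eq f g -> dhom_eq (dsusp f) (dsusp g).
Proof.
elim=> {X Y f g} /=.
- by move=> *; exact: DRefl.
- by move=> X Y f g _; exact: DSym.
- by move=> X Y f g h _ fg _; exact: DTrans.
- by move=> X Y Z g g' f f' _ gg' _; exact: DCompEq.
- by move=> *; exact: DAssoc.
- move=> X Y f; apply: DTrans (DIdl _); apply: DCompEq (DRefl _).
  exact: dsusp_id.
- move=> X Y f; apply: DTrans (DIdr _); apply: DCompEq (DRefl _) _.
  exact: dsusp_id.
- by move=> X Y f g fg; apply: DMapEq => i x; exact: fg.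
- move=> X Y Z g f; apply: DTrans (DMapComp _ _); exact: DMapEq.
- by move=> X Y w qw; apply: DTrans (DInvl _) _; apply/DSym/dsusp_id.
- by move=> X Y w qw; apply: DTrans (DInvr _) _; apply/DSym/dsusp_id.
Qed.

Definition derived_susp : functor derived_cat derived_cat :=
  @MkFunctor derived_cat derived_cat (@susp R) dsusp dsusp_eq dsusp_id
    (fun X Y Z g f => DRefl _).

(* A triangle is distinguished if it is isomorphic in D(R) to the mapping cone
   triangle X' -> Y' -> cone u -> sX' of a chain map u. *)
Definition derived_distinguished (X Y Z : derived_cat)
    (f : hom X Y) (g : hom Y Z) (h : hom Z (derived_susp X)) : Prop :=
  exists (X' Y' : complex R) (u : chain_map X' Y')
    (a : @hom derived_cat X X') (b : @hom derived_cat Y Y')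
    (c : @hom derived_cat Z (cone u)),
    [/\ is_iso a, is_iso b & is_iso c] /\
    [/\ b \oc f =h (DMap u : @hom derived_cat _ _) \oc a,
        c \oc g =h (DMap (cone_in u) : @hom derived_cat _ _) \oc b &
        fmap derived_susp a \oc h
          =h (DMap (cone_out u) : @hom derived_cat _ _) \oc c].

Definition derived : triang_data :=
  @MkTriang derived_cat derived_susp derived_distinguished.

(** * The subcategory of complexes with bounded, finitely generated homology *)

Lemma homology_fgP (M : complex R) (i : int) :
  finitely_generated (homology M i) <->
  exists (m : nat) (g : 'I_m -> M i), (forall k, cdiff M i (g k) = 0) /\
    forall x : M i, cdiff M i x = 0 ->
      exists c : 'I_m -> R, boundary (x - \sum_k c k *: g k).
Proof.
have valE m (c : 'I_m -> R) (z : 'I_m -> cycle M i) :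
    cycle_val (\sum_k c k *: z k) = \sum_k c k *: cycle_val (z k).
  rewrite -[LHS]/((val : cycle M i -> M i) _) raddf_sum.
  by apply: eq_bigr => k _; exact: linearZ.
have clE m (c : 'I_m -> R) (z : 'I_m -> cycle M i) :
    homology_class (\sum_k c k *: z k) = \sum_k c k *: homology_class (z k).
  by rewrite raddf_sum; apply: eq_bigr => k _; exact: linearZ.
split=> [[m [g gP]]|[m [g [dg gP]]]].
  have [z zE] := choice (fun k => homology_class_surj (g k)).
  exists m, (fun k => cycle_val (z k)); split=> [k|x dx]; first exact: cycle_eq0.
  have xc : x \in @cycle_pred R M i by apply/eqP.
  have [c cE] := gP (homology_class (MkCycle xc)); exists c.
  rewrite -valE; apply/(homology_eq (MkCycle xc)).
  by rewrite cE clE; apply: eq_bigr => k _; rewrite zE.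
have gc k : g k \in @cycle_pred R M i by apply/eqP.
exists m, (fun k => homology_class (MkCycle (gc k))) => h.
have [x ->] := homology_class_surj h; have [c b] := gP _ (cycle_eq0 x).
by exists c; rewrite -clE; apply/homology_eq; rewrite valE.
Qed.

Lemma homology_eq0P (M : complex R) (i : int) :
  (forall h : homology M i, h = 0) <->
  (forall x : M i, cdiff M i x = 0 -> boundary x).
Proof.
have cl0 : homology_class (0 : cycle M i) = 0 by exact: linear0.
have val0 : cycle_val (0 : cycle M i) = 0 by exact: (raddf0 (val : cycle M i -> M i)).
split=> [h0 x dx|b h].
  have xc : x \in @cycle_pred R M i by apply/eqP.
  have /homology_eq : homology_class (MkCycle xc) = homology_class 0 by rewrite [LHS]h0 [RHS]h0.
  by rewrite val0 subr0.
have [x ->] := homology_class_surj h; rewrite -cl0; apply/homology_eq.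
by rewrite val0 subr0; exact/b/cycle_eq0.
Qed.

Definition qc (M : complex R) : Prop :=
  (forall i : int, finitely_generated (homology M i)) /\
  finite_set [set i : int | exists h : homology M i, h != 0].

Lemma qc_susp (M : complex R) : qc M -> qc (susp M).
Proof.
move=> [fg bd]; split=> [i|].
  have /homology_fgP[m [g [dg gP]]] := fg (i - 1); apply/homology_fgP.
  exists m, g; split=> [k|x /eqP]; rewrite /= ?dg ?oppr0 // oppr_eq0 => /eqP dx.
  by have [c b] := gP x dx; exists c; apply/boundary_susp.
apply: sub_finite_set (finite_image (fun j : int => j + 1) bd) => i /= ih.
exists (i - 1); last by rewrite subrK.
apply: contrapT => nh; case: ih => h /eqP; apply.
apply: (homology_eq0P (susp M) i).2 h => x /eqP.
rewrite /= oppr_eq0 => /eqP dx; apply/boundary_susp.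
apply: (homology_eq0P M (i - 1)).1 x dx => h.
by apply/eqP; apply: contra_notT nh => h0; exists h.
Qed.

Definition Dqc : triang_data := @sub_triang derived qc qc_susp.

Definition phi (A : Dqc -> Prop) (n : int) (p : Spec R) : Prop :=
  exists2 M : Dqc, A M & spec_closure (@Ass R (homology (sval M) n)) p.

End Derived.

(* Main.v *)
From HB Require Import structures.
From mathcomp Require Import all_boot all_order all_algebra.
From mathcomp Require Import mathcomp_extra boolp classical_sets functions cardinality.
From mathcomp Require Import zify.
Require Import Defs.

Set Implicit Arguments.
Unset Strict Implicit.
Unset Printing Implicit Defensive.

Import Order.TTheory GRing.Theory Num.Theory.
Local Open Scope ring_scope.
Local Open Scope quotient_scope.

(* Write [X] for [R/p] placed in degree [n + 1] and let [U -> X -> V] be its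
   truncation triangle for the aisle; [U] is replaced by a bounded below complex
   of projective modules, so that all maps out of objects of the aisle are
   homotopy classes of chain maps.  If [p] is not in [phi A (n + 1)], then [p]
   is not in the support of [homology U (n + 1)], so the generator of [R/p] gives
   a class in [homology V (n + 1)] which no element outside [p] annihilates.

   Let [K(s; V)] be the iterated cone of [V] along multiplication by the elements
   of [s].  It is still right orthogonal to the aisle, up to a shift by [size s].
   If [s] generates [p'] (and more), the homology of [K(s; V)] is killed by [p'].
   Were it nonzero in a high degree, its top degree [i] would have an associated
   prime [q] containing [p']; a suspension of an object of the aisle witnessing
   [p' \in phi A n] has lowest [q]-local homology exactly in degree [i], and a
   nonzero map from that homology module to [R/q] lifts to a map which is
   nonzero on homology, against orthogonality.  So [K(s; V)] has no
   homology in high degrees.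

   Take [s] to consist of generators of [p], one [x] in [p'] outside [p], and
   generators of [p'].  Since [p] is maximal under [p'], the latter are
   nilpotent modulo [p + (x)] locally at [p'], so they can be removed from [s]
   without changing the degree of [p']-local vanishing.  Removing [x], by
   Nakayama, costs exactly one degree and gives a vanishing that contradicts the
   class coming from [R/p]. *)

(** * Prime ideals and finitely generated modules *)

(* A decision procedure for equations between sums in an additive group. *)
Inductive zterm := ZVar of nat | ZZero | ZAdd of zterm & zterm | ZOpp of zterm.

Fixpoint zeval (V : zmodType) (e : seq V) (t : zterm) : V :=
  match t with
  | ZVar k => nth 0 e k
  | ZZero => 0
  | ZAdd u v => zeval e u + zeval e v
  | ZOpp u => - zeval e u
  end.

Fixpoint zcoef (t : zterm) (k : nat) : int :=
  match t with
  | ZVar l => (l == k)%:R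
  | ZZero => 0
  | ZAdd u v => zcoef u k + zcoef v k
  | ZOpp u => - zcoef u k
  end.

Lemma zevalE (V : zmodType) (e : seq V) (t : zterm) :
  zeval e t = \sum_(k < size e) nth 0 e k *~ zcoef t k.
Proof.
elim: t => [k||u IHu v IHv|u IHu] /=; rewrite ?IHu ?IHv.
- have [ke|ke] := ltnP k (size e); last first.
    rewrite nth_default // big1 // => l _.
    by rewrite gtn_eqF ?mulr0z // (leq_trans (ltn_ord l)).
  rewrite (bigD1 (Ordinal ke)) //= eqxx big1 ?addr0 // => l /eqP lk.
  by case: eqP => [kl|]; rewrite ?mulr0z //; case: lk; exact: val_inj.
- by rewrite big1 // => k _; rewrite mulr0z.
- by rewrite -big_split; apply: eq_bigr => k _; rewrite mulrzDr.
- by rewrite -sumrN; apply: eq_bigr => k _; rewrite mulrNz.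
Qed.

Lemma zeval_eq (V : zmodType) (e : seq V) (t u : zterm) :
  all (fun k => zcoef t k == zcoef u k) (iota 0 (size e)) ->
  zeval e t = zeval e u.
Proof.
move=> /allP tu; rewrite !zevalE; apply: eq_bigr => k _; congr (_ *~ _).
by apply/eqP/tu; rewrite mem_iota /=.
Qed.

Ltac zindex x e :=
  match e with
  | ?y :: _ => let _ := match goal with _ => unify x y end in constr:(0%N)
  | _ :: ?e' => let k := zindex x e' in constr:(k.+1)
  end.
Ltac zmember x e :=
  match e with
  | nil => constr:(false)
  | ?y :: _ => let _ := match goal with _ => unify x y end in constr:(true)
  | _ :: ?e' => zmember x e'
  end.
Ltac zatoms x e :=
  lazymatch x with
  | 0 => e
  | ?u + ?v => let e' := zatoms u e in zatoms v e'
  | - ?u => zatoms u e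
  | _ => match zmember x e with true => e | false => constr:(x :: e) end
  end.
Ltac zreify x e :=
  lazymatch x with
  | 0 => constr:(ZZero)
  | ?u + ?v =>
      let u' := zreify u e in let v' := zreify v e in constr:(ZAdd u' v')
  | - ?u => let u' := zreify u e in constr:(ZOpp u')
  | _ => let k := zindex x e in constr:(ZVar k)
  end.
Ltac abel :=
  lazymatch goal with
  | |- @eq ?T ?x ?y =>
      let e := zatoms x (@nil T) in let e := zatoms y e in
      let t := zreify x e in let u := zreify y e in
      exact: (@zeval_eq _ e t u isT)
  end.

(** * Elementary properties of prime ideals *)

Section Spectrum.
Variables (R : comPzRingType) (p : Spec R).

Lemma spec0 : 0 \in p. Proof. by have [] := spec_ideal p. Qed.

Lemma specZD a u v : u \in p -> v \in p -> a * u + v \in p.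
Proof. by have [_] := spec_ideal p; exact. Qed.

Lemma specD u v : u \in p -> v \in p -> u + v \in p.
Proof. by move=> up vp; rewrite -[u]mul1r; exact: specZD. Qed.

Lemma specMl a u : u \in p -> a * u \in p.
Proof. by move=> up; rewrite -[a * u]addr0 specZD ?spec0. Qed.

Lemma specMr a u : u \in p -> u * a \in p.
Proof. by rewrite mulrC; exact: specMl. Qed.

Lemma specN u : u \in p -> - u \in p.
Proof. by rewrite -mulN1r; exact: specMl. Qed.

Lemma specB u v : u \in p -> v \in p -> u - v \in p.
Proof. by move=> up vp; rewrite specD ?specN. Qed.

Lemma spec1 : 1 \notin p. Proof. exact: spec_proper. Qed.

Lemma specM u v : (u * v \in p) = (u \in p) || (v \in p).
Proof.
apply/idP/idP; first exact: spec_prime.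
by move=> /orP[]; [exact: specMr | exact: specMl].
Qed.

Lemma spec_prod (I : finType) (F : I -> R) :
  (forall i, F i \notin p) -> \prod_i F i \notin p.
Proof.
move=> Fp; elim/big_rec: _ => [|i x _ xp]; first exact: spec1.
by rewrite specM negb_or Fp.
Qed.

End Spectrum.

Lemma scaler_swap (R : comPzRingType) (V : lmodType R) (a b : R) (v : V) :
  a *: (b *: v) = b *: (a *: v).
Proof. by rewrite !scalerA mulrC. Qed.

(** Without such an index, choice produces a strictly ascending chain of ideals starting at [t0].
    Its union is finitely generated, and all the generators already lie in one member of the
    chain. *)
Lemma noetherian_max (R : comPzRingType) (T : Type) (I : T -> {pred R^o}) (t0 : T) :
  noetherian R -> (forall t, submod_closed (I t)) ->
  exists t, forall t', {subset I t <= I t'} -> {subset I t' <= I t}.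
Proof.
move=> nR Icl; apply: contrapT => nmax.
have ascend t : exists t', {subset I t <= I t'} /\ ~ {subset I t' <= I t}.
  apply: contrapT => h; apply: nmax; exists t => t' sub; apply: contrapT => nsub.
  by apply: h; exists t'.
have [f fP] := choice ascend; pose u k := iter k f t0.
have u_mono (k l : nat) x : (k <= l)%N -> x \in I (u k) -> x \in I (u l).
  move=> /subnKC <-; elim: (l - k)%N => [|m IHm]; first by rewrite addn0.
  by rewrite addnS => /IHm; apply: (fP _).1.
pose J : {pred R^o} := [pred x | `[< exists k, x \in I (u k) >]].
have Jcl : submod_closed J.
  split=> [|a x y].
    by apply/asboolP; exists 0; have [] := Icl (u 0).
  move=> /asboolP[k xk] /asboolP[l yl]; apply/asboolP; exists (maxn k l).
  have [_ cl] := Icl (u (maxn k l)).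
  by apply: cl; [apply: u_mono xk; exact: leq_maxl | apply: u_mono yl; exact: leq_maxr].
have [m [g gP]] := nR J Jcl.
have gJ i : exists k, g i \in I (u k).
  have : g i \in J.
    apply/gP; exists (fun j => (j == i)%:R); rewrite (bigD1 i) //= eqxx mul1r.
    by rewrite big1 ?addr0 // => j /negbTE ->; rewrite mul0r.
  by move=> /asboolP.
(* [N] bounds the stages at which the generators appear, so the ideal of [u N] is the whole union
   and contains the next one. *)
have [k kP] := choice gJ; pose N := \max_i k i.
apply: (fP (u N)).2 => x xN.
have /gP[c ->] : x \in J by apply/asboolP; exists N.+1.
have [I0 Icl'] := Icl (u N).
elim/big_rec: _ => [|i y _ yN] //; apply: Icl' => //.
by apply: u_mono (kP i); exact: leq_bigmax.
Qed.

(** An annihilator that is maximal among those of the multiples of [b] not killed by any element of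
    [S] is prime. With [S] reduced to 1 this gives an associated prime of [H]; with [S] the
    complement of a prime, an associated prime inside that prime. *)
Lemma prime_annihilator (R : comPzRingType) (H : lmodType R) (S : R -> Prop) (b : H) :
  noetherian R -> S 1 -> (forall u v, S u -> S v -> S (u * v)) ->
  (forall s, S s -> s *: b <> 0) ->
  exists (q : Spec R) (r : R), (forall s, (s \in q) = (s *: (r *: b) == 0)) /\
    forall s, S s -> s \notin q.
Proof.
move=> nR S1 SM Sb.
pose T := {r : R | forall s, S s -> s *: (r *: b) <> 0}.
pose ann (t : T) : {pred R^o} := [pred s : R | s *: (sval t *: b) == 0].
have t0 : T by exists 1 => s Ss; rewrite scale1r; exact: Sb.
have anncl t : submod_closed (ann t).
  split=> [|a u v]; rewrite !inE ?scale0r // => /eqP u0 /eqP v0.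
  by rewrite scalerDl -scalerA u0 v0 scaler0 addr0.
have [[r rS] rmax] := noetherian_max t0 nR anncl.
(* By maximality, multiplying [r *: b] by [u] does not enlarge the annihilator as long as [S] kills
   no multiple obtained. *)
have step u : (forall s, S s -> s *: ((u * r) *: b) <> 0) ->
    forall v, v *: ((u * r) *: b) = 0 -> v *: (r *: b) = 0.
  move=> uS v v0; apply/eqP.
  apply: (rmax (exist _ (u * r) uS)); last by rewrite inE /= v0.
  move=> s /eqP s0; apply/eqP; rewrite /= in s0 *.
  by rewrite -scalerA scaler_swap s0 scaler0.
have aprime u v : ann (exist _ r rS) (u * v) ->
    ann (exist _ r rS) u || ann (exist _ r rS) v.
  rewrite /= => /eqP uv0; apply/orP.
  have [uS|] := pselect (forall s, S s -> s *: ((u * r) *: b) <> 0).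
    right; apply/eqP; apply: (step u) => //.
    by rewrite -scalerA scaler_swap scalerA.
  (* Otherwise some [t] in [S] kills [u *: (r *: b)]. Then [u] kills the [t]-multiple of [r *: b],
     which [S] still does not kill, and [step t] applies. *)
  move=> /existsNP[t /not_implyP[St /contrapT tu0]]; left; apply/eqP.
  apply: (step t) => [s Ss|].
    by rewrite -scalerA scalerA; apply: (rS); exact: SM.
  by rewrite -scalerA scaler_swap (scalerA u).
have aproper : ~~ ann (exist _ r rS) 1 by apply/eqP; exact: (rS).
exists (MkSpec (anncl _) aproper aprime), r; split=> // s Ss.
by apply/eqP; exact: (rS).
Qed.

Definition mk_submod (R : pzRingType) (V : lmodType R) (I : {pred V})
    (Icl : submod_closed I) : submodClosed V :=
  HB.pack_for (submodClosed V) I (GRing.isSubmodClosed.Build R V I Icl).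

Definition mk_linear (R : pzRingType) (U V : lmodType R) (f : U -> V)
    (fl : linear f) : {linear U -> V} :=
  HB.pack_for {linear U -> V} f (GRing.isLinear.Build R U V *:%R f fl).

Lemma quotient_exists (R : comPzRingType) (V : lmodType R) (I : {pred V}) :
  submod_closed I ->
  exists (Q : lmodType R) (pi : {linear V -> Q}),
    (forall x, (pi x == 0) = (x \in I)) /\ forall y, exists x, pi x = y.
Proof.
move=> Icl; pose Q := quotmod (mk_submod Icl).
have pil : linear (fun x : V => \pi_Q x).
  by move=> a x y; rewrite -quotmod_piD -quotmod_scaleE.
exists Q, (mk_linear pil); split=> [x|y]; last by exists (repr y); exact: reprK.
by rewrite -[0](linear0 (mk_linear pil)) /= quotmod_eq subr0.
Qed.

(** Apply [prime_annihilator] to the class of 1 in R/I; the annihilator of any multiple of this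
    class contains [I]. *)
Lemma prime_avoiding (R : comPzRingType) (I : {pred R^o}) (S : R -> Prop) :
  noetherian R -> submod_closed I -> S 1 ->
  (forall u v, S u -> S v -> S (u * v)) -> (forall s, S s -> s \notin I) ->
  exists q : Spec R, {subset I <= q} /\ forall s, S s -> s \notin q.
Proof.
move=> nR Icl S1 SM SI; have [Q [pi [piE _]]] := quotient_exists Icl.
have pi1 (s : R^o) : s *: pi 1 = pi s by rewrite -linearZ /= [s *: _]mulr1.
have Sb s : S s -> s *: pi 1 <> 0.
  by move=> Ss /eqP; rewrite pi1 piE; apply/negP; exact: SI.
have [q [r [qE qS]]] := prime_annihilator nR S1 SM Sb; exists q; split=> // s.
by rewrite qE scaler_swap pi1 -piE => /eqP ->; rewrite scaler0.
Qed.

(* [rho] is a nonzero linear form with values in the domain [R/q]. *)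
Lemma local_functional (R : comPzRingType) (H : lmodType R) (q : Spec R) (b : H) :
  finitely_generated H -> (forall s, s *: b = 0 -> s \in q) ->
  exists rho : H -> R,
    (forall a u v, rho (a *: u + v) - (a * rho u + rho v) \in q) /\
    exists h, rho h \notin q.
Proof.
move=> [m [g gP]] bq.
pose span (l : nat) (h : H) :=
  exists c : 'I_m -> R, h = \sum_(i < m | (i < l)%N) c i *: g i.
have spanZD l a u v : span l u -> span l v -> span l (a *: u + v).
  move=> [c ->] [d ->]; exists (fun i => a * c i + d i).
  rewrite scaler_sumr -big_split /=; apply: eq_bigr => i _.
  by rewrite scalerDl scalerA.
have spanZ l a u : span l u -> span l (a *: u).
  move=> su; rewrite -[_ *: _]addr0; apply: spanZD => //.
  by exists (fun=> 0); rewrite big1 // => i _; rewrite scale0r.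
have spanB l u v : span l u -> span l v -> span l (v - u).
  by move=> su sv; rewrite addrC -scaleN1r; exact: spanZD.
(* Some denominator outside [q] carries all of [H] into the span of the first [l] generators. At the
   threshold between not good and good, the last generator is locally indispensable. *)
pose good l := exists s, s \notin q /\ forall h, span l (s *: h).
have goodm : good m.
  exists 1; split=> [|h]; first exact: spec1.
  have [c hE] := gP h; exists c; rewrite scale1r hE.
  by apply: eq_bigl => i; rewrite ltn_ord.
have ngood0 : ~ good 0%N.
  move=> [s [sq /(_ b)[c]]]; rewrite big_pred0 // => /bq.
  by apply/negP.
have [l [gl ngl]] : exists l : 'I_m, good l.+1 /\ ~ good l.
  apply: contrapT => /forallNP h; apply: ngood0.
  have : forall k, (k <= m)%N -> good (m - k)%N; last first.
    by move=> /(_ m (leqnn m)); rewrite subnn.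
  elim=> [|k IHk] km; first by rewrite subn0.
  have lt : (m - k.+1 < m)%N by rewrite ltn_subrL (leq_trans _ km).
  have /not_andP[] := h (Ordinal lt); last by move=> /contrapT.
  by rewrite /= subnSK //; case; exact/IHk/ltnW.
have [s [sq sP]] := gl.
have dec h : exists r, span l (s *: h - r *: g l).
  have [c ->] := sP h; exists (c l), c.
  rewrite (bigD1 l) //= addrAC subrr add0r.
  by apply: eq_bigl => i; rewrite ltnS [RHS]ltn_neqAle andbC.
(* The coefficient of [g l] is therefore well defined modulo [q]: a relation with a coefficient
   outside [q] would make [l] good. So [rho] reads off the coefficient of [g l] in [s *: h]. *)
have uniq_r r : span l (r *: g l) -> r \in q.
  move=> sr; apply: contraT => rq; exfalso; apply: ngl; exists (r * s).
  split=> [|h]; first by rewrite specM negb_or rq.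
  have [r' sr'] := dec h; rewrite -scalerA.
  rewrite -(subrK (r' *: g l) (s *: h)) scalerDr; apply: spanZD => //.
  by rewrite scalerA mulrC -scalerA; exact: spanZ.
have [rho rhoP] := choice dec; exists rho; split=> [a u v|].
  apply: uniq_r; rewrite scalerBl scalerDl -scalerA.
  have := spanB _ _ _ (rhoP (a *: u + v)) (spanZD _ a _ _ (rhoP u) (rhoP v)).
  congr (span _ _); rewrite !scalerBr scalerDr !scalerA (mulrC s a).
  abel.
(* Modulo [q] the value at [g l] is [s], which is outside [q]. *)
exists (g l); apply/negP => rq.
have : span l ((s - rho (g l)) *: g l) by rewrite scalerBl; exact: rhoP.
move=> /uniq_r; move=> /specD /(_ rq); rewrite subrK.
by apply/negP.
Qed.

Lemma linear_mod0 (R : comPzRingType) (H : lmodType R) (q : Spec R) (rho : H -> R) :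
  (forall a u v, rho (a *: u + v) - (a * rho u + rho v) \in q) -> rho 0 \in q.
Proof.
move=> /(_ 1 0 0); rewrite scaler0 addr0 mul1r opprD addNKr => /specN.
by rewrite opprK.
Qed.

(** * Generation by lists, with one generator peeled off at a time *)

Fixpoint span (R : comPzRingType) (H : lmodType R) (s : seq H) (x : H) : Prop :=
  if s is g :: s' then exists r : R, span s' (x - r *: g) else x = 0.

Section Span.
Variables (R : comPzRingType) (H : lmodType R).
Implicit Types (s t : seq H) (x y : H).

Lemma span_ZD s a x y : span s x -> span s y -> span s (a *: x + y).
Proof.
elim: s x y => [|g s IHs] x y /=; first by move=> -> ->; rewrite scaler0 addr0.
move=> [r sx] [r' sy]; exists (a * r + r').
have -> : a *: x + y - (a * r + r') *: g = a *: (x - r *: g) + (y - r' *: g).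
  by rewrite scalerBr scalerDl scalerA; abel.
exact: IHs.
Qed.

Lemma span_cat s t x y : span s x -> span t (y - x) -> span (s ++ t) y.
Proof.
elim: s x y => [|g s IHs] x y /=; first by move=> ->; rewrite subr0.
move=> [r sx] ty; exists r; apply: (IHs (x - r *: g)) => //.
by have -> : y - r *: g - (x - r *: g) = y - x by abel.
Qed.

Lemma span0 s : span s 0.
Proof. by elim: s => //= g s IHs; exists 0; rewrite scale0r subr0. Qed.

Lemma span_sum (I : finType) (s : seq H) (F : I -> H) :
  (forall i, span s (F i)) -> span s (\sum_i F i).
Proof.
move=> sF; elim/big_rec: _ => [|i x _ sx]; first exact: span0.
by rewrite -[F i]scale1r; exact: span_ZD.
Qed.

Lemma span_codom m (g : 'I_m -> H) (c : 'I_m -> R) :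
  span (codom g) (\sum_i c i *: g i).
Proof.
rewrite -big_enum /codom /image_mem; elim: (enum _) => [|i s IHs] /=.
  by rewrite big_nil.
by exists (c i); rewrite big_cons addrAC subrr add0r.
Qed.

Lemma fg_span : finitely_generated H <-> exists s, forall x, span s x.
Proof.
have sumE (s : seq H) x : span s x ->
    exists c : nat -> R, x = \sum_(i < size s) c i *: s`_i.
  elim: s x => [|g s IHs] x /=; first by move=> ->; exists (fun=> 0); rewrite big_ord0.
  move=> [r /IHs[c xE]]; exists (fun i => if i is j.+1 then c j else r).
  by rewrite big_ord_recl /= -xE addrC subrK.
split=> [[m [g gP]]|[s sP]].
  by exists (codom g) => x; have [c ->] := gP x; exact: span_codom.
exists (size s), (fun i => s`_i) => x; have [c ->] := sumE s x (sP x).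
by exists (fun i => c i).
Qed.

End Span.

Lemma span_map (R : comPzRingType) (A B : lmodType R) (f : {linear A -> B})
    (s : seq A) (x : A) : span s x -> span (map f s) (f x).
Proof.
elim: s x => [|g s IHs] x /=; first by move=> ->; rewrite linear0.
by move=> [r sx]; exists r; rewrite -linearZ -linearB; exact: IHs.
Qed.

Definition submodule (R : comPzRingType) (H : lmodType R) (N : H -> Prop) :=
  N 0 /\ forall a u v, N u -> N v -> N (a *: u + v).

(** Induction on the generators: the coefficients at [g] of elements of [N] form an ideal, which is
    finitely generated. Elements of [N] realising its generators, together with generators of the
    part of [N] spanned by the tail, generate [N]. *)
Lemma noetherian_submodule (R : comPzRingType) (H : lmodType R) (s : seq H)
    (N : H -> Prop) :
  noetherian R -> submodule N -> (forall x, N x -> span s x) ->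
  exists t : seq H, (forall g, g \in t -> N g) /\ forall x, N x -> span t x.
Proof.
move=> nR; elim: s N => [|g s IHs] N Nsub Ns.
  by exists nil; split.
have [N0 NZD] := Nsub.
pose I : {pred R^o} := [pred r : R | `[< exists2 x, N x & span s (x - r *: g) >]].
have Icl : submod_closed I.
  split=> [|a u v].
    by apply/asboolP; exists 0 => //; rewrite scale0r subr0; exact: span0.
  move=> /asboolP[x Nx sx] /asboolP[y Ny sy]; apply/asboolP.
  exists (a *: x + y); first exact: NZD.
  have -> : a *: x + y - (a *: u + v : R^o) *: g = a *: (x - u *: g) + (y - v *: g).
    by rewrite scalerDl -scalerA scalerBr; abel.
  exact: span_ZD.
have [m [r rP]] := nR I Icl.
have rI i : exists x, N x /\ span s (x - r i *: g).
  have : r i \in I.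
    apply/rP; exists (fun j => (j == i)%:R); rewrite (bigD1 i) //= eqxx mul1r.
    by rewrite big1 ?addr0 // => j /negbTE ->; rewrite mul0r.
  by move=> /asboolP[x ? ?]; exists x.
have [x xP] := choice rI.
have [t [tN tP]] : exists t : seq H, (forall h, h \in t -> N h) /\
    forall y, N y /\ span s y -> span t y.
  have [|y []//|t [tN tP]] := IHs (fun y => N y /\ span s y).
    split; first by split=> //; exact: span0.
    by move=> a u v [? ?] [? ?]; split; [exact: NZD | exact: span_ZD].
  by exists t; split=> // h /tN[].
exists (codom x ++ t); split=> [h|y Ny].
  by rewrite mem_cat => /orP[/codomP[i ->]|/tN//]; have [] := xP i.
have [a sy] := Ns y Ny.
have /rP[c aE] : a \in I by apply/asboolP; exists y.
apply: (span_cat (x := \sum_i c i *: x i)).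
  exact: span_codom.
(* Subtracting the combination of the [x i] cancels the coefficient [a] of [g] and leaves an element
   of [N] in the span of the tail. *)
apply: tP; split.
  rewrite addrC -scaleN1r; apply: (NZD _ _ _ _ Ny).
  by elim/big_rec: _ => // i z _ Nz; apply: NZD => //; have [] := xP i.
have -> : y - \sum_i c i *: x i =
    (y - a *: g) + \sum_i (- c i) *: (x i - r i *: g).
  rewrite aE scaler_suml -[in RHS]addrA; congr (_ + _).
  rewrite -!sumrN -big_split /=; apply: eq_bigr => i _.
  by rewrite scalerBr !scaleNr scalerA; abel.
rewrite -[y - _]scale1r; apply: span_ZD => //; apply: span_sum => i.
by rewrite -[_ *: _]addr0; apply: span_ZD (span0 _); have [] := xP i.
Qed.

(** The image of [B] in [C] is finitely generated because the ring is noetherian; lifts of its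
    generators together with the images of generators of [A] generate [B]. *)
Lemma fg_middle (R : comPzRingType) (A B C : lmodType R) (f : {linear A -> B})
    (g : {linear B -> C}) :
  noetherian R -> (forall b, g b = 0 -> exists a, f a = b) ->
  finitely_generated A -> finitely_generated C -> finitely_generated B.
Proof.
move=> nR exact_fg /fg_span[s sP] /fg_span[t tP]; apply/fg_span.
have [||u [uB uP]] := @noetherian_submodule R C t (fun c => exists b, g b = c) nR.
- split=> [|a _ _ [b <-] [b' <-]]; first by exists 0; rewrite linear0.
  by exists (a *: b + b'); rewrite linearP.
- by move=> c _.
have [v vP] : exists v : seq B, map g v = u.
  elim: u uB {uP} => [|c u IHu] uB; first by exists nil.
  have [|v <-] := IHu; first by move=> c' c'u; apply: uB; rewrite inE c'u orbT.
  by have [b <-] := uB c (mem_head _ _); exists (b :: v).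
exists (v ++ map f s) => b.
have [b' vb' gb'] : exists2 b', span v b' & g b' = g b.
  have : span u (g b) by apply: uP; exists b.
  rewrite -vP; elim: v {vP uP} (g b) => [|h v IHv] c /=.
    by move=> ->; exists 0; rewrite ?linear0.
  move=> [r /IHv[b' vb' gb']]; exists (b' + r *: h).
    by exists r; rewrite addrK.
  by rewrite linearD linearZ /= gb' subrK.
apply: span_cat vb' _.
have [|a <-] := exact_fg (b - b'); first by rewrite linearB gb' subrr.
exact: span_map.
Qed.

(** * Free modules and recursion over the integers *)

(** Extends a family known up to degree [k] upwards, one degree at a time. Here [good] is the
    invariant that makes the next step possible, and [rel] is the relation between neighbouring
    degrees; resolutions, homotopies and chain maps are all built this way. *)
Lemma dependent_choice_int (T : int -> Type) (good : forall j, T j -> Prop)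
    (rel : forall j, T (j - 1) -> T j -> Prop) (z : forall j, T j) (k : int) :
  (forall j, j <= k -> good j (z j)) ->
  (forall j, j <= k -> rel j (z (j - 1)) (z j)) ->
  (forall j a, k < j -> good (j - 1) a -> exists b, good j b /\ rel j a b) ->
  exists h : forall j, T j,
    [/\ forall j, j <= k -> h j = z j, forall j, good j (h j) &
        forall j, rel j (h (j - 1)) (h j)].
Proof.
move=> gz rz step.
have stepT j (a : T (j - 1)) :
    exists b, k < j -> good (j - 1) a -> good j b /\ rel j a b.
  have [[kj ga]|] := pselect (k < j /\ good (j - 1) a).
    by have [b bP] := step j a kj ga; exists b.
  by move=> h; exists (z j) => ? ?; case: h.
pose next j := projT1 (choice (stepT j)).
have nextP j := projT2 (choice (stepT j)).
(* Calling degree [j - 1] from degree [j] keeps the types in the shape of [rel], without transport.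
   The fuel is the distance of [j] above [k], and 0 below. *)
pose rec := fix rec m j : T j :=
  if m is m'.+1 then next j (rec m' (j - 1)) else z j.
pose fuel (j : int) := if j - k is Posz m then m else 0%N.
have fuelS j m : fuel j = m.+1 -> k < j /\ fuel (j - 1) = m.
  rewrite /fuel; case E: (j - k) => [[|l]|//] // [<-]; split; first lia.
  by have -> : j - 1 - k = Posz l by lia.
have fuel0 j : fuel j = 0%N -> j <= k.
  by rewrite /fuel; case E: (j - k) => [m|m]; lia.
have fuelle j : j <= k -> fuel j = 0%N.
  by rewrite /fuel; case E: (j - k) => [m|m]; lia.
have recg m j : fuel j = m -> good j (rec m j).
  elim: m j => [|m IHm] j; first by move=> /fuel0; exact: gz.
  by move=> /fuelS[kj fj]; apply: (nextP _ _ kj _).1; exact: IHm.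
exists (fun j => rec (fuel j) j); split=> j.
- by move=> /fuelle ->.
- exact: recg.
- case E: (fuel j) => [|m].
    have jk := fuel0 _ E; have -> : fuel (j - 1) = 0%N by apply: fuelle; lia.
    exact: rz.
  have [kj E'] := fuelS _ _ E; rewrite E'.
  by apply: (nextP _ _ kj _).2; exact: recg.
Qed.

Lemma int_pred (i : int) : exists j, i = j - 1.
Proof. by exists (i + 1); rewrite addrK. Qed.

(** Components of homotopies and cones are indexed by [i] but have source in degree [i - 1]; this
    turns such families into candidates for chain maps. *)
Lemma reindex_pred (T : int -> Type) (f : forall i, T (i - 1)) :
  exists g : forall i, T i, forall i, g (i - 1) = f i.
Proof.
have e (i : int) : i + 1 - 1 = i by rewrite addrK.
exists (fun i : int => ecast j (T j) (e i) (f (i + 1))) => i.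
have [j ij] : exists j, j = i - 1 + 1 by exists (i - 1 + 1).
move: (e (i - 1)); rewrite -ij => ej.
have ji : j = i by rewrite ij subrK.
by case: i / ji ij ej => ij ej; rewrite (eq_irrelevance ej erefl).
Qed.

(** * The free module on an arbitrary type *)

Section Free.
Variables (R : comPzRingType) (T : Type).

Inductive lterm := LVar of T | LZero | LAdd of lterm & lterm
  | LScale of R & lterm.

Fixpoint leval (L : lmodType R) (v : T -> L) (t : lterm) : L :=
  match t with
  | LVar x => v x
  | LZero => 0
  | LAdd t u => leval v t + leval v u
  | LScale a t => a *: leval v t
  end.

(** Formal combinations are identified when they agree under every assignment in every module, so
    the module laws and the universal property are inherited from the targets. *)
Definition lequiv (t u : lterm) : bool :=
  `[< forall (L : lmodType R) (v : T -> L), leval v t = leval v u >].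

Fact lequiv_refl : reflexive lequiv. Proof. by move=> t; apply/asboolP. Qed.
Fact lequiv_sym : symmetric lequiv.
Proof. by move=> t u; apply/asboolP/asboolP => e L v; rewrite e. Qed.
Fact lequiv_trans : transitive lequiv.
Proof.
by move=> t u w /asboolP e /asboolP e'; apply/asboolP => L v; rewrite e.
Qed.

HB.instance Definition _ := gen_eqMixin lterm.
HB.instance Definition _ := gen_choiceMixin lterm.

Canonical lequiv_equiv := EquivRel lequiv lequiv_refl lequiv_sym lequiv_trans.

Definition free_module := {eq_quot lequiv_equiv}.
HB.instance Definition _ := Choice.on free_module.
HB.instance Definition _ := Quotient.on free_module.

Definition free_eval (L : lmodType R) (v : T -> L) (x : free_module) : L :=
  leval v (repr x).

Lemma free_evalE (L : lmodType R) (v : T -> L) (t : lterm) :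
  free_eval v (\pi_free_module t) = leval v t.
Proof.
have /eqmodP/asboolP : \pi_free_module (repr (\pi_free_module t)) = \pi_free_module t by rewrite reprK.
exact.
Qed.

Lemma free_ext (x y : free_module) :
  (forall (L : lmodType R) (v : T -> L), free_eval v x = free_eval v y) -> x = y.
Proof.
move=> xy; rewrite -[x]reprK -[y]reprK; apply/eqmodP/asboolP => L v.
exact: xy.
Qed.

Definition free_add (x y : free_module) : free_module := \pi_free_module (LAdd (repr x) (repr y)).
Definition free_zero : free_module := \pi_free_module LZero.
Definition free_scale (a : R) (x : free_module) : free_module := \pi_free_module (LScale a (repr x)).
Definition free_opp (x : free_module) : free_module := free_scale (- 1) x.

Let addE (L : lmodType R) (v : T -> L) x y :
  free_eval v (free_add x y) = free_eval v x + free_eval v y.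
Proof. by rewrite free_evalE. Qed.
Let scaleE (L : lmodType R) (v : T -> L) a x : free_eval v (free_scale a x) = a *: free_eval v x.
Proof. by rewrite free_evalE. Qed.
Let zeroE (L : lmodType R) (v : T -> L) : free_eval v free_zero = 0.
Proof. by rewrite free_evalE. Qed.
Let E := (addE, scaleE, zeroE).

Fact free_addA : associative free_add.
Proof. by move=> x y z; apply: free_ext => L v; rewrite !E addrA. Qed.
Fact free_addC : commutative free_add.
Proof. by move=> x y; apply: free_ext => L v; rewrite !E addrC. Qed.
Fact free_add0 : left_id free_zero free_add.
Proof. by move=> x; apply: free_ext => L v; rewrite !E add0r. Qed.
Fact free_addN : left_inverse free_zero free_opp free_add.
Proof. by move=> x; apply: free_ext => L v; rewrite !E scaleN1r addNr. Qed.

HB.instance Definition _ :=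
  GRing.isZmodule.Build free_module free_addA free_addC free_add0 free_addN.

Fact free_scaleA a b x : free_scale a (free_scale b x) = free_scale (a * b) x.
Proof. by apply: free_ext => L v; rewrite !E scalerA. Qed.
Fact free_scale1 : left_id 1 free_scale.
Proof. by move=> x; apply: free_ext => L v; rewrite !E scale1r. Qed.
Fact free_scaleDr : right_distributive free_scale +%R.
Proof. by move=> a x y; apply: free_ext => L v; rewrite !E scalerDr. Qed.
Fact free_scaleDl x : {morph free_scale^~ x : a b / a + b}.
Proof. by move=> a b; apply: free_ext => L v; rewrite !E scalerDl. Qed.

HB.instance Definition _ := GRing.Zmodule_isLmodule.Build R free_module
  free_scaleA free_scale1 free_scaleDr free_scaleDl.

Definition free_var (x : T) : free_module := \pi_free_module (LVar x).

Fact free_eval_linear (L : lmodType R) (v : T -> L) : linear (free_eval v).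
Proof. by move=> a x y; rewrite -[_ + _]/(free_add (free_scale a x) y) !E. Qed.
HB.instance Definition _ (L : lmodType R) (v : T -> L) := GRing.isLinear.Build R free_module L *:%R
  (@free_eval L v) (@free_eval_linear L v).

Lemma free_eval_var (L : lmodType R) (v : T -> L) x :
  free_eval v (free_var x) = v x.
Proof. exact: free_evalE. Qed.

Lemma free_linear_ext (L : lmodType R) (f g : {linear free_module -> L}) :
  (forall x, f (free_var x) = g (free_var x)) -> forall y, f y = g y.
Proof.
move=> fg y; rewrite -[y]reprK.
have addP t u : \pi_free_module (LAdd t u) = \pi_free_module t + \pi_free_module u :> free_module.
  by apply: free_ext => M v; rewrite linearD /= !free_evalE.
have scaleP a t : \pi_free_module (LScale a t) = a *: \pi_free_module t :> free_module.
  by apply: free_ext => M v; rewrite linearZ /= !free_evalE.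
elim: (repr y) => [x||t IHt u IHu|a t IHt]; first exact: fg.
- by rewrite -[\pi_free_module _]/(0 : free_module) !linear0.
- by rewrite addP !linearD IHt IHu.
- by rewrite scaleP !linearZ /= IHt.
Qed.

End Free.

(** Asking that [f] land in the image of [g], rather than that [g] be onto, allows lifting directly
    through a differential. *)
Definition projective (R : comPzRingType) (L : lmodType R) : Prop :=
  forall (A B : lmodType R) (g : {linear A -> B}) (f : {linear L -> B}),
    (forall x, exists a, g a = f x) ->
    exists h : {linear L -> A}, forall x, g (h x) = f x.

Lemma projective_free (R : comPzRingType) (T : Type) : projective (free_module R T).
Proof.
move=> A B g f fg; have [u uP] := choice (fun x => fg (free_var R x)).
exists (free_eval u) => x.
apply: (@free_linear_ext R T B (g \o free_eval u)) => y.
by rewrite /= free_eval_var.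
Qed.

Lemma projective_prod (R : comPzRingType) (L M : lmodType R) :
  projective L -> projective M -> projective (L * M)%type.
Proof.
move=> pL pM A B g f fg.
have il : linear (fun x : L => (x, 0 : M)).
  by move=> a x y; congr pair; rewrite /= scaler0 addr0.
have ir : linear (fun y : M => (0 : L, y)).
  by move=> a x y; congr pair; rewrite /= scaler0 addr0.
have [|h hP] := pL A B g (f \o mk_linear il) _; first by move=> x; exact: fg.
have [|k kP] := pM A B g (f \o mk_linear ir) _; first by move=> x; exact: fg.
have hkl : linear (fun x : L * M => h x.1 + k x.2).
  by move=> a x y; rewrite /= !linearP /= scalerDr; abel.
exists (mk_linear hkl) => -[x y]; rewrite /= linearD hP kP /= -linearD.
by congr (f _); congr pair; rewrite /= ?addr0 ?add0r.
Qed.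

Lemma zero_module (R : comPzRingType) : exists Z : lmodType R, forall x : Z, x = 0.
Proof. by exists ('rV[R]_0 : lmodType R) => x; apply/rowP => -[]. Qed.

(** * Homotopies *)

Section Homotopy.
Variable R : comPzRingType.
Implicit Types (L M N P C X Y : complex R).

Lemma boundary_predP M (i : int) (x : M (i - 1)) :
  boundary x <-> exists y : M i, x = cdiff M i y.
Proof.
split=> [/boundaryP[j [e [y ->]]]|[y ->]]; last exact: Boundary.
have ij : j = i by apply: addIr e.
by case: i / ij e x => e _; exists y; rewrite (eq_irrelevance e erefl).
Qed.

Lemma boundaryD M i (x y : M i) : boundary x -> boundary y -> boundary (x + y).
Proof. by move=> bx by_; rewrite -[x]scale1r; exact: boundary_linear. Qed.

Lemma boundaryZ M i a (x : M i) : boundary x -> boundary (a *: x).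
Proof. by move=> bx; rewrite -[_ *: _]addr0; apply: boundary_linear => //; exact: boundary0. Qed.

Lemma boundaryN M i (x : M i) : boundary x -> boundary (- x).
Proof. by rewrite -scaleN1r; exact: boundaryZ. Qed.

Lemma boundaryB M i (x y : M i) : boundary x -> boundary y -> boundary (x - y).
Proof. by move=> bx by_; apply: boundaryD => //; exact: boundaryN. Qed.

Lemma boundary_cycle M i (x : M i) : boundary x -> cdiff M i x = 0.
Proof. by case=> j y; exact: cdiffK. Qed.

(** The homotopy is indexed by its target degree and the identity is written in degree [i - 1], so
    that all types match without transport. *)
Definition htpy M N (f g : chain_map M N) : Prop :=
  exists h : forall i, {linear M (i - 1) -> N i}, forall i (x : M (i - 1)),
    cdiff N i (h i x) + h (i - 1) (cdiff M (i - 1) x) = f (i - 1) x - g (i - 1) x.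

Definition zero_map M N : chain_map M N :=
  @MkChainMap R M N (fun i => \0) (fun i x => esym (linear0 _)).

Lemma htpy_ext M N (f g : chain_map M N) : (forall i x, f i x = g i x) -> htpy f g.
Proof.
move=> fg; exists (fun i => \0) => i x.
by rewrite fg subrr linear0 add0r.
Qed.

Lemma htpy_refl M N (f : chain_map M N) : htpy f f.
Proof. exact: htpy_ext. Qed.

Lemma htpy_sym M N (f g : chain_map M N) : htpy f g -> htpy g f.
Proof.
move=> [h hP]; exists (fun i => \- h i) => i x /=.
by rewrite linearN -opprD hP opprB.
Qed.

Lemma htpy_trans M N (f g k : chain_map M N) : htpy f g -> htpy g k -> htpy f k.
Proof.
move=> [h hP] [l lP]; exists (fun i => h i \+ l i) => i x /=.
by rewrite linearD addrACA hP lP; abel.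
Qed.

Lemma htpy_compl L M N (k : chain_map M N) (f g : chain_map L M) :
  htpy f g -> htpy (chain_comp k f) (chain_comp k g).
Proof.
move=> [h hP]; exists (fun i => k i \o h i) => i x /=.
by rewrite -cmapP -linearD hP linearB.
Qed.

Lemma htpy_compr L M N (k : chain_map L M) (f g : chain_map M N) :
  htpy f g -> htpy (chain_comp f k) (chain_comp g k).
Proof.
move=> [h hP]; exists (fun i => h i \o k (i - 1)) => i x /=.
by rewrite cmapP hP.
Qed.

Lemma htpy_boundary M N (f g : chain_map M N) i (x : M i) :
  htpy f g -> cdiff M i x = 0 -> boundary (f i x - g i x).
Proof.
have [j ij] := int_pred i; subst i => -[h hP] dx.
by rewrite -hP dx linear0 addr0; exact: Boundary.
Qed.

Definition acyclic C : Prop := forall i (x : C i), cdiff C i x = 0 -> boundary x.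

Definition bounded_projective P : Prop :=
  (forall i, projective (P i)) /\
  exists k : int, forall i, i <= k -> forall x : P i, x = 0.

(** The contracting homotopy is built upwards from the degree below which [P] vanishes, lifting
    through the differential of [C] by projectivity. *)
Lemma htpy_acyclic P C (f : chain_map P C) :
  bounded_projective P -> acyclic C -> htpy f (zero_map P C).
Proof.
move=> [Pproj [k Pk]] Cacy.
pose T (j : int) := {linear P (j - 1) -> C j}.
(* On cycles the homotopy already bounds [f]. This is what makes [f] minus the homotopy after the
   differential a cycle, hence a boundary, one degree higher. *)
pose good j (h : T j) :=
  forall u, cdiff P (j - 1) u = 0 -> cdiff C j (h u) = f (j - 1) u.
pose rel j (a : T (j - 1)) (b : T j) := forall x : P (j - 1),
  cdiff C j (b x) + a (cdiff P (j - 1) x) = f (j - 1) x.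
have Pk' j (u : P (j - 1)) : j <= k -> u = 0 by move=> jk; apply: Pk; lia.
have [|||h [_ _ hP]] := @dependent_choice_int T good rel (fun j => \0) k.
- by move=> j jk u _; rewrite (Pk' _ u jk) !linear0.
- by move=> j jk x; rewrite (Pk' _ x jk) !linear0 addr0.
- move=> j a _ ga.
  have [|b bP] := Pproj (j - 1) (C j) (C (j - 1)) (cdiff C j)
      (f (j - 1) \- (a \o cdiff P (j - 1))) _.
    move=> x; have /boundary_predP[y yE] :
        boundary (f (j - 1) x - a (cdiff P (j - 1) x)).
      by apply: Cacy; rewrite linearB -cmapP ga ?subrr ?cdiffK.
    by exists y.
  have bP' x : cdiff C j (b x) + a (cdiff P (j - 1) x) = f (j - 1) x.
    by rewrite bP /= subrK.
  exists b; split=> // u du; have := bP' u.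
  by rewrite du linear0 addr0.
by exists h => i x; rewrite hP subr0.
Qed.

Lemma boundary_cone X Y (f : chain_map X Y) i (z : cone f (i - 1)) :
  boundary z <-> exists (y : Y i) (x : X (i - 1)),
    z.1 = cdiff Y i y + f (i - 1) x /\ z.2 = - cdiff X (i - 1) x.
Proof.
split=> [/boundary_predP[[y x] ->]|[y [x [z1 z2]]]]; first by exists y, x.
apply/boundary_predP; exists ((y, x) : cone f i).
by case: z z1 z2 => z1 z2 /= -> ->.
Qed.

Lemma acyclic_cone X Y (w : chain_map X Y) : quasi_iso w -> acyclic (cone w).
Proof.
move=> /quasi_isoP wq i; have [j ij] := int_pred i; subst i => -[y x] [dy /eqP].
rewrite oppr_eq0 => /eqP dx.
have [w1 _] := wq (j - 1 - 1).
have /(w1 _ dx)/boundary_predP[x' x'E] : boundary (w (j - 1 - 1) x).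
  have -> : w (j - 1 - 1) x = cdiff Y (j - 1) (- y).
    by rewrite linearN; apply: (addrI (cdiff Y (j - 1) y)); rewrite dy subrr.
  exact: Boundary.
have [_ w2] := wq (j - 1).
have [|x'' dx'' /boundary_predP[y' y'E]] := w2 (y + w (j - 1) x').
  by rewrite linearD -cmapP -x'E dy.
apply/boundary_cone; exists (- y'), (x'' - x') => /=.
split; first by rewrite linearN linearB -y'E; abel.
by rewrite linearB dx'' sub0r opprK.
Qed.

Lemma bounded_projective_susp P : bounded_projective P -> bounded_projective (susp P).
Proof.
move=> [Pproj [k Pk]]; split=> [i|]; first exact: Pproj.
by exists k => i ik x; apply: Pk; lia.
Qed.

(** The composite of [g] with the inclusion into the acyclic cone of [w] is null-homotopic. The
    [X]-component of the null-homotopy is the lift, and minus its [Y]-component is the homotopy from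
    [w] after the lift to [g]. *)
Lemma lift_quasi_iso P X Y (w : chain_map X Y) (g : chain_map P Y) :
  bounded_projective P -> quasi_iso w ->
  exists g' : chain_map P X, htpy (chain_comp w g') g.
Proof.
move=> Ppr /acyclic_cone wq.
have [h hP] := htpy_acyclic (chain_comp (cone_in w) g) Ppr wq.
have s2l i : linear (fun x : P (i - 1) => (h i x).2).
  by move=> a u v; rewrite linearP.
have s1l i : linear (fun x : P (i - 1) => - (h i x).1).
  by move=> a u v; rewrite linearP /= opprD scalerN.
have [g' g'E] := @reindex_pred (fun i => {linear P i -> X i}) (fun i => mk_linear (s2l i)).
have hP1 i x : cdiff Y i (h i x).1 + w (i - 1) (h i x).2 +
    (h (i - 1) (cdiff P (i - 1) x)).1 = g (i - 1) x.
  by have /(congr1 fst) := hP i x; rewrite /= subr0.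
have hP2 i x : (h (i - 1) (cdiff P (i - 1) x)).2 = cdiff X (i - 1) (h i x).2.
  have /(congr1 snd) := hP i x; rewrite /= subr0 => e.
  by apply: (addrI (- cdiff X (i - 1) (h i x).2)); rewrite e addNr.
have g'P i x : g' (i - 1) (cdiff P i x) = cdiff X i (g' i x).
  have [j ij] := int_pred i; subst i.
  by rewrite !g'E /= hP2.
exists (MkChainMap g'P), (fun i => mk_linear (s1l i)) => i x /=.
by rewrite linearN g'E /= -hP1; abel.
Qed.

(** A homotopy between the composites, paired with [b - a], is a chain map from [susp P] to the
    acyclic cone of [w]; the [X]-component of its null-homotopy relates [a] and [b]. *)
Lemma quasi_iso_inj P X Y (w : chain_map X Y) (a b : chain_map P X) :
  bounded_projective P -> quasi_iso w ->
  htpy (chain_comp w a) (chain_comp w b) -> htpy a b.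
Proof.
move=> Ppr /acyclic_cone wq [k kP].
have tl i : linear (fun x : susp P i => (k i x, b (i - 1) x - a (i - 1) x) : cone w i).
  move=> r u v; rewrite !linearP /=; congr pair => /=.
  by rewrite ?scalerDr ?scalerN; abel.
have tP i (x : susp P i) : mk_linear (tl (i - 1)) (cdiff (susp P) i x) =
    cdiff (cone w) i (mk_linear (tl i) x).
  rewrite /= /cone_diff_fun /= !linearN !linearB -!cmapP /=; congr pair.
  have /= e := kP i x.
  by rewrite -(opprB (w (i - 1) (a (i - 1) x))) -e; abel.
have [h hP] := htpy_acyclic (@MkChainMap R (susp P) (cone w) _ tP) (bounded_projective_susp Ppr) wq.
have s2l i : linear (fun x : P (i - 1 - 1) => (h i x).2).
  by move=> r u v; rewrite linearP.
have [l lE] := @reindex_pred (fun i => {linear P (i - 1) -> X i}) (fun i => mk_linear (s2l i)).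
exists l => i x; have [j ij] := int_pred i; subst i.
have /(congr1 snd) := hP j x; rewrite !lE /= subr0 linearN /= => e.
by rewrite -(opprB (b (j - 1 - 1) x)) -e; abel.
Qed.

End Homotopy.

(** * Resolutions and triangles *)

Section Resolution.
Variables (R : comPzRingType) (X : complex R).

(* A module in degree [j] of a resolution of [X] under construction; only the
   kernel of [stage_diff] matters for the next degree. *)
Record stage (j : int) := Stage {
  stage_mod : lmodType R;
  stage_target : lmodType R;
  stage_diff : {linear stage_mod -> stage_target};
  stage_map : {linear stage_mod -> X j}
}.

Lemma resolution_exists (k : int) :
  (forall i, i <= k -> forall x : X i, cdiff X i x = 0 -> boundary x) ->
  exists (P : complex R) (w : chain_map P X), bounded_projective P /\ quasi_iso w.
Proof.
move=> Xk; have [Z Z0] := zero_module R.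
pose z j := @Stage j Z Z \0 \0.
pose good j (a : stage j) := projective (stage_mod a).
(* [d] replaces [stage_diff b], whose target is not literally the module of [a]; equal kernels
   suffice. The last clause makes the map to [X] a quasi-isomorphism above degree [k]. *)
pose rel j (a : stage (j - 1)) (b : stage j) :=
  exists d : {linear stage_mod b -> stage_mod a},
  [/\ forall y, stage_diff b y = 0 <-> d y = 0,
      forall y, stage_diff a (d y) = 0,
      forall y, stage_map a (d y) = cdiff X j (stage_map b y) &
      k < j -> forall x y, stage_diff a y = 0 -> stage_map a y = cdiff X j x ->
        exists u, d u = y /\ stage_map b u = x].
have [|||s [sz sproj srel]] := @dependent_choice_int stage good rel z k.
- by move=> j _ A B g f _; exists \0 => x; rewrite /= (Z0 x) !linear0.
- move=> j jk; exists \0; split=> //= [y|]; first by rewrite linear0.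
  by move=> kj; lia.
- move=> j a kj _.
  (* One free generator for each cycle of degree [j - 1] together with a chain bounding its image in
     [X]. Pairs with zero first entry hit all cycles of [X j]; the others kill the classes that die
     in [X]. *)
  pose T := {u : stage_mod a * X j |
    stage_diff a u.1 = 0 /\ stage_map a u.1 = cdiff X j u.2}.
  pose d : {linear free_module R T -> stage_mod a} := free_eval (fun t : T => (sval t).1).
  pose f : {linear free_module R T -> X j} := free_eval (fun t : T => (sval t).2).
  exists (@Stage j (free_module R T) _ d f); split; first exact: projective_free.
  exists d; split=> //.
  + move=> y; apply: (@free_linear_ext R T _ (stage_diff a \o d) \0) => t.
    by rewrite /= free_eval_var; have [] := svalP t.
  + move=> y; apply: (@free_linear_ext R T _ (stage_map a \o d) (cdiff X j \o f)) => t.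
    by rewrite /= !free_eval_var; have [] := svalP t.
  + move=> _ x y dy fy; exists (free_var R (exist _ (y, x) (conj dy fy) : T)).
    by rewrite /= !free_eval_var.
pose d j := projT1 (cid (srel j)).
have dP j := projT2 (cid (srel j)); rewrite -/(d _) in dP.
have dK j y : d (j - 1) (d j y) = 0.
  by have [_ /(_ y) h _ _] := dP j; have [/(_ (d j y))[/(_ h)]] := dP (j - 1).
pose P := @MkComplex R (fun j => stage_mod (s j)) d dK.
have wP j (y : P j) : stage_map (s (j - 1)) (cdiff P j y) = cdiff X j (stage_map (s j) y).
  by have [_ _ /(_ y)] := dP j.
exists P, (MkChainMap wP); split.
  by split=> //; exists k => j jk; rewrite /= sz.
apply/quasi_isoP => i; split=> [y dy|x dx].
  have [j ij] := int_pred i; subst i => /boundary_predP[x xE].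
  apply/boundary_predP; have [kj|jk] := ltP k j.
    have [_ _ _ /(_ kj x y)] := dP j; case=> // [|u [<- _]]; last by exists u.
    have [/(_ y) h _ _ _] := dP (j - 1).
    exact/h.
  exists 0; rewrite linear0; have jk' : j - 1 <= k by lia.
  by move: y {dy xE}; rewrite /= (sz _ jk').
have [ki|ik] := ltP k i; last first.
  by exists 0; rewrite ?linear0 // sub0r; apply/boundaryN/(Xk _ ik).
have [_ _ _ /(_ ki x 0)] := dP i; case; rewrite ?linear0 //.
by move=> u [du ux]; exists u; rewrite //= ux subrr; exact: boundary0.
Qed.

End Resolution.

(** * Maps into cones, and extensions of complexes *)

Section Triangles.
Variable R : comPzRingType.
Implicit Types (L M N P Q U X Y W : complex R).

(** Exactness of maps from [P] into a cone triangle: the null-homotopy [k] of the component in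
    [susp X] corrects the [Y]-component by [e] after [k], and the result is a chain map. *)
Lemma htpy_cone_in X Y P (e : chain_map X Y) (g : chain_map P (cone e)) :
  htpy (chain_comp (cone_out e) g) (zero_map P (susp X)) ->
  exists g' : chain_map P Y, htpy g (chain_comp (cone_in e) g').
Proof.
move=> [h hP].
have [k kE] := @reindex_pred (fun i => {linear P i -> X i}) h.
have kP i (x : P i) : k (i - 1) (cdiff P i x) = (g i x).2 + cdiff X i (k i x).
  have [j ij] := int_pred i; subst i.
  have hE : - cdiff X (j - 1) (h j x) + h (j - 1) (cdiff P (j - 1) x) =
      (g (j - 1) x).2 by have := hP j x; rewrite /= subr0.
  by rewrite !kE -hE; abel.
have g'l i : linear (fun x : P i => (g i x).1 - e i (k i x)).
  by move=> a u v; rewrite !linearP /= ?scalerDr ?scalerN; abel.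
have g'P i (x : P i) :
    mk_linear (g'l (i - 1)) (cdiff P i x) = cdiff Y i (mk_linear (g'l i) x).
  by rewrite /= cmapP kP /= linearD linearB -cmapP; abel.
exists (MkChainMap g'P).
have hl i : linear (fun x : P (i - 1) => (0, k (i - 1) x) : cone e i).
  by move=> a u v; rewrite !linearP; congr pair; rewrite /= scaler0 addr0.
exists (fun i => mk_linear (hl i)) => i x /=.
rewrite /cone_in_fun [g (i - 1) x]surjective_pairing; congr pair => /=.
  by rewrite linear0; abel.
by rewrite kP; abel.
Qed.

Lemma htpy_cone_in0 X Y (e : chain_map X Y) :
  htpy (chain_comp (cone_in e) e) (zero_map X (cone e)).
Proof.
have hl i : linear (fun x : X (i - 1) => (0, x) : cone e i).
  by move=> a u v; congr pair; rewrite /= scaler0 addr0.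
exists (fun i => mk_linear (hl i)) => i x /=.
by congr pair; rewrite /= ?linear0; abel.
Qed.

Lemma htpy_desusp P W (g : chain_map (susp P) (susp W)) :
  (forall f : chain_map P W, htpy f (zero_map P W)) ->
  htpy g (zero_map (susp P) (susp W)).
Proof.
move=> Pnull.
have [f fE] := @reindex_pred (fun i => {linear P i -> W i}) (fun i => g i).
have fP i (x : P i) : f (i - 1) (cdiff P i x) = cdiff W i (f i x).
  have [j ij] := int_pred i; subst i; rewrite !fE.
  by have := cmapP g x; rewrite /= linearN => /oppr_inj.
have [h hP] := Pnull (MkChainMap fP).
exists (fun i => \- h (i - 1)) => i x; have /= := hP (i - 1) x.
rewrite !fE subr0 => <-.
by rewrite (linearN (cdiff W (i - 1))) (linearN (h (i - 1 - 1))); abel.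
Qed.

(* The extension of [Q] by [U] classified by [q : Q -> susp U]. *)
Section Extension.
Variables (Q U : complex R) (q : chain_map Q (susp U)).

Definition ext_obj (i : int) : lmodType R := (U i * Q i)%type.

Definition ext_diff_fun (i : int) (z : ext_obj i) : ext_obj (i - 1) :=
  (cdiff U i z.1 + q i z.2, cdiff Q i z.2).

Fact ext_diff_linear i : linear (@ext_diff_fun i).
Proof.
by move=> a u v; congr pair; rewrite /= !linearP //= scalerDr; abel.
Qed.
HB.instance Definition _ i := GRing.isLinear.Build R (ext_obj i)
  (ext_obj (i - 1)) *:%R (@ext_diff_fun i) (@ext_diff_linear i).

Fact ext_diffK i (z : ext_obj i) : ext_diff_fun (ext_diff_fun z) = 0.
Proof.
by congr pair; rewrite /= ?linearD !cdiffK // add0r cmapP /= subrr.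
Qed.

Definition ext : complex R :=
  @MkComplex R ext_obj (fun i => @ext_diff_fun i) ext_diffK.

Fact ext_in_linear i : linear (fun u : U i => (u, 0) : ext i).
Proof. by move=> a u v; congr pair; rewrite /= scaler0 addr0. Qed.

Fact ext_in_subproof i (u : U i) :
  mk_linear (@ext_in_linear (i - 1)) (cdiff U i u) =
  cdiff ext i (mk_linear (@ext_in_linear i) u).
Proof. by congr pair; rewrite /= linear0 ?addr0. Qed.

Definition ext_in : chain_map U ext :=
  @MkChainMap R U ext (fun i => mk_linear (@ext_in_linear i)) ext_in_subproof.

Fact ext_out_linear i : linear (fun z : ext i => z.2).
Proof. by []. Qed.

Definition ext_out : chain_map ext Q :=
  @MkChainMap R ext Q (fun i => mk_linear (@ext_out_linear i)) (fun i z => erefl).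

Fact ext_quot_linear i : linear (fun z : cone ext_in i => z.1.2).
Proof. by []. Qed.

Fact ext_quot_subproof i (z : cone ext_in i) :
  mk_linear (@ext_quot_linear (i - 1)) (cdiff (cone ext_in) i z) =
  cdiff Q i (mk_linear (@ext_quot_linear i) z).
Proof. by rewrite /= addr0. Qed.

Definition ext_quot : chain_map (cone ext_in) Q :=
  @MkChainMap R (cone ext_in) Q (fun i => mk_linear (@ext_quot_linear i))
    ext_quot_subproof.

(** The map is onto and its kernel is the cone of the identity of [U], which is acyclic. Thus [Q]
    completes [ext_in] to a triangle. *)
Lemma quasi_iso_ext_quot : quasi_iso ext_quot.
Proof.
apply/quasi_isoP => i; have [j ij] := int_pred i; subst i; split.
  move=> -[[u a] v] [] /= du _ _ /boundary_predP[c /= ac].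
  apply/boundary_cone; exists ((0, c) : ext j), (u - q j c) => /=; split.
    congr pair => /=; last by rewrite ac addr0.
    by rewrite linear0; abel.
  have /= := cmapP q c; rewrite -ac => qa.
  by apply: (addrI (cdiff U (j - 1) u + q (j - 1) a)); rewrite du linearB qa; abel.
move=> a da.
exists ((0, a), - q (j - 1) a : U (j - 1 - 1)).
  have /= := cmapP q a; rewrite da linear0 => qa.
  congr pair; first congr pair => /=.
  - by rewrite linear0 add0r; exact: subrr.
  - by rewrite da addr0.
  - by rewrite /= linearN -qa oppr0.
by rewrite /= subrr; exact: boundary0.
Qed.

Lemma bounded_projective_ext :
  bounded_projective U -> bounded_projective Q -> bounded_projective ext.
Proof.
move=> [Up [k Uk]] [Qp [l Ql]]; split=> [i|]; first exact: projective_prod.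
exists (Order.min k l) => i; rewrite le_min => /andP[ik il] [u a].
by rewrite (Uk _ ik u) (Ql _ il a).
Qed.

End Extension.

End Triangles.

(** * Maps in the derived category out of projective complexes *)

Section DerivedMaps.
Variable R : comPzRingType.
Implicit Types (L M N P Q U X Y W : complex R).

(* [cone diagonal] is the cylinder of [M]. *)
Section Cylinder.
Variable M : complex R.
(** The extension classified by zero, that is, the direct sum of two copies of [M]. *)
Let MM := ext (zero_map M (susp M)).

Fact diagonal_linear i : linear (fun x : M i => (x, - x) : MM i).
Proof. by move=> a u v; congr pair; rewrite /= opprD scalerN. Qed.

Fact diagonal_subproof i (x : M i) :
  mk_linear (@diagonal_linear (i - 1)) (cdiff M i x) =
  cdiff MM i (mk_linear (@diagonal_linear i) x).
Proof. by congr pair; rewrite /= ?addr0 ?linearN. Qed.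

Definition diagonal : chain_map M MM :=
  @MkChainMap R M MM (fun i => mk_linear (@diagonal_linear i)) diagonal_subproof.

Fact cyl_map_linear (N : complex R) (f g : chain_map M N)
    (h : forall i, {linear M (i - 1) -> N i}) i :
  linear (fun z : cone diagonal i => f i z.1.1 + g i z.1.2 + h i z.2).
Proof. by move=> a u v; rewrite /= !linearP /= !scalerDr; abel. Qed.

(** A homotopy from [f] to [g] is a map out of the cylinder restricting to [f] and [g] on its two
    ends. *)
Lemma cyl_map (N : complex R) (f g : chain_map M N)
    (h : forall i, {linear M (i - 1) -> N i}) :
  (forall i (x : M (i - 1)),
    cdiff N i (h i x) + h (i - 1) (cdiff M (i - 1) x) = f (i - 1) x - g (i - 1) x) ->
  exists k : chain_map (cone diagonal) N,
    forall i z, k i z = f i z.1.1 + g i z.1.2 + h i z.2.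
Proof.
move=> hP.
have kP i (z : cone diagonal i) :
    mk_linear (cyl_map_linear f g h (i := i - 1)) (cdiff (cone diagonal) i z) =
    cdiff N i (mk_linear (cyl_map_linear f g h (i := i)) z).
  rewrite /= addr0 !linearD /= linearN /= -!cmapP.
  have -> : cdiff N i (h i z.2) = f (i - 1) z.2 - g (i - 1) z.2 -
      h (i - 1) (cdiff M (i - 1) z.2) by rewrite -hP; abel.
  by rewrite (linearN (h (i - 1))); abel.
by exists (MkChainMap kP).
Qed.

Fact cyl_right_linear i : linear (fun x : M i => (0, x) : MM i).
Proof. by move=> a u v; congr pair; rewrite /= scaler0 addr0. Qed.

Fact cyl_right_subproof i (x : M i) :
  mk_linear (@cyl_right_linear (i - 1)) (cdiff M i x) =
  cdiff MM i (mk_linear (@cyl_right_linear i) x).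
Proof. by congr pair; rewrite /= linear0 addr0. Qed.

Definition cyl_left : chain_map M (cone diagonal) :=
  chain_comp (cone_in diagonal) (ext_in (zero_map M (susp M))).
Definition cyl_right : chain_map M (cone diagonal) :=
  chain_comp (cone_in diagonal)
    (@MkChainMap R M MM (fun i => mk_linear (@cyl_right_linear i)) cyl_right_subproof).

(** Both ends are sections of the projection [s] given by the constant homotopy. As [s] is a
    quasi-isomorphism, both equal its formal inverse. *)
Lemma cyl_left_right : dhom_eq (DMap cyl_left) (DMap cyl_right).
Proof.
have [i x|s sE] := @cyl_map M (chain_id M) (chain_id M) (fun i => \0).
  by rewrite /= linear0 add0r subrr.
have sq : quasi_iso s.
  apply/quasi_isoP => i; have [j ij] := int_pred i; subst i; split.
    move=> -[[a b] c] [] /= _ db _; rewrite sE /= addr0 => /boundary_predP[e ab].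
    apply/boundary_cone; exists ((e, 0) : MM j), (- b : M (j - 1)) => /=; split.
      congr pair => /=; first by rewrite -ab; abel.
      by rewrite linear0 opprK add0r.
    by rewrite linearN opprK; apply/eqP; rewrite eq_sym -subr_eq0 db.
  move=> y dy; exists ((y, 0), 0); last by rewrite sE /= !addr0 subrr; exact: boundary0.
  by congr pair; [congr pair|]; rewrite /= ?dy ?linear0 ?oppr0 ?addr0.
have key (i0 : chain_map M (cone diagonal)) : (forall i x, s i (i0 i x) = x) ->
    dhom_eq (DMap i0) (DInv sq).
  move=> si; apply: DTrans (DSym (DIdl _)) _.
  apply: DTrans (DCompEq (DSym (DInvl sq)) (DRefl _)) _.
  apply: DTrans (DSym (DAssoc _ _ _)) _.
  apply: DTrans (DCompEq (DRefl _) _) (DIdr _).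
  by apply: DTrans (DSym (DMapComp _ _)) _; apply: DMapEq => i x; exact: si.
apply: DTrans (key _ _) (DSym (key _ _)) => i x; rewrite sE /=.
  by rewrite !addr0.
by rewrite add0r addr0.
Qed.

End Cylinder.

Lemma htpy_dhom_eq M N (f g : chain_map M N) : htpy f g -> dhom_eq (DMap f) (DMap g).
Proof.
move=> [h hP]; have [k kE] := cyl_map hP.
have e (i0 : chain_map M (cone (diagonal M))) (f0 : chain_map M N) :
    (forall i x, k i (i0 i x) = f0 i x) -> dhom_eq (DMap f0) (DComp (DMap k) (DMap i0)).
  move=> kf; apply: DTrans (DMapComp _ _); apply: DMapEq => i x.
  by rewrite /= kf.
apply: DTrans (e (cyl_left M) f _) _ => [i x|].
  by rewrite kE /= !linear0 !addr0.
apply: DTrans (DCompEq (DRefl _) (cyl_left_right M)) (DSym _).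
by apply: e => i x; rewrite kE /= !linear0 addr0 add0r.
Qed.

(** * Action of derived morphisms on homotopy classes of maps out of [P] *)

Section Action.
Variable P : complex R.
Hypothesis Pproj : bounded_projective P.

(** Postcomposition, as a relation because lifts through quasi-isomorphisms are determined only up
    to homotopy. *)
Fixpoint act X Y (f : dhom X Y) : chain_map P X -> chain_map P Y -> Prop :=
  match f with
  | DMap _ _ f => fun a b => htpy (chain_comp f a) b
  | DInv _ _ w _ => fun a b => htpy (chain_comp w b) a
  | DComp _ _ _ g f => fun a c => exists2 b, act f a b & act g b c
  end.

Lemma act_total X Y (f : dhom X Y) a : exists b, act f a b.
Proof.
elim: f a => {X Y} [X Y f|X Y w qw|X Y Z g IHg f IHf] a /=.
- by exists (chain_comp f a); exact: htpy_refl.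
- exact: lift_quasi_iso.
- by have [b fab] := IHf a; have [c gbc] := IHg b; exists c, b.
Qed.

Lemma act_htpy X Y (f : dhom X Y) a b a' b' :
  htpy a a' -> htpy b b' -> act f a b -> act f a' b'.
Proof.
elim: f a b a' b' => {X Y} [X Y f|X Y w qw|X Y Z g IHg f IHf] a b a' b' aa' bb' /=.
- move=> fab; apply: htpy_trans (htpy_trans fab bb').
  exact/htpy_compl/htpy_sym.
- move=> fab; apply: htpy_trans (htpy_trans fab aa').
  exact/htpy_compl/htpy_sym.
- move=> [c ac cb]; exists c; first exact: (IHf _ _ _ _ aa' (htpy_refl _) ac).
  exact: (IHg _ _ _ _ (htpy_refl _) bb' cb).
Qed.

(** Each generating relation preserves the action. The two relations for formal inverses rest on
    uniqueness and existence of lifts through quasi-isomorphisms. *)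
Lemma act_dhom_eq X Y (f g : dhom X Y) : dhom_eq f g ->
  forall a b, act f a b <-> act g a b.
Proof.
elim=> {X Y f g} /=.
- by [].
- by move=> X Y f g _ fg a b; split=> /fg.
- by move=> X Y f g h _ fg _ gh a b; split=> [/fg/gh|/gh/fg].
- move=> X Y Z g g' f f' _ gg' _ ff' a b.
  by split=> -[c /ff' ac /gg' cb]; exists c.
- move=> W X Y Z h g f a d; split=> [[c [b ab bc] cd]|[b ab [c bc cd]]].
    by exists b => //; exists c.
  by exists c => //; exists b.
- move=> X Y f a b; split=> [[c ac cb]|ab].
    by apply: (act_htpy (htpy_refl _) _ ac); apply: htpy_trans cb; exact: htpy_ext.
  by exists b => //; exact: htpy_ext.
- move=> X Y f a b; split=> [[c ac cb]|ab].
    by apply: (act_htpy _ (htpy_refl _) cb); apply: htpy_sym; apply: htpy_trans ac; exact: htpy_ext.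
  by exists a => //; exact: htpy_ext.
- move=> X Y f g fg a b; split; apply: htpy_trans; apply: htpy_ext => i x /=.
    by rewrite fg.
  by rewrite fg.
- move=> X Y Z g f a c; split=> [gfa|[b fab gbc]].
    by exists (chain_comp f a); [exact: htpy_refl | apply: htpy_trans gfa; exact: htpy_ext].
  apply: htpy_trans gbc; apply: htpy_trans (htpy_compl g fab); exact: htpy_ext.
- move=> X Y w qw a c; split=> [[b wa wc]|ac].
    apply: htpy_trans (quasi_iso_inj Pproj qw (htpy_trans wa (htpy_sym wc))).
    exact: htpy_ext.
  exists (chain_comp w a); first exact: htpy_refl.
  by apply/htpy_compl/htpy_sym; apply: htpy_trans ac; exact: htpy_ext.
- move=> X Y w qw a c; split=> [[b wb wc]|ac].
    apply: htpy_trans (htpy_trans (htpy_sym wb) wc); exact: htpy_ext.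
  have [b wb] := lift_quasi_iso a Pproj qw; exists b => //.
  by apply: htpy_trans wb _; apply: htpy_trans ac; exact: htpy_ext.
Qed.

Lemma act_comp X Y (f : dhom X Y) a b :
  act f a b -> dhom_eq (DComp f (DMap a)) (DMap b).
Proof.
elim: f a b => {X Y} [X Y f|X Y w qw|X Y Z g IHg f IHf] a b /=.
- by move=> fab; apply: DTrans (DSym (DMapComp _ _)) _; exact: htpy_dhom_eq.
- move=> /htpy_dhom_eq wb; apply: DTrans (DCompEq (DRefl _) (DSym wb)) _.
  apply: DTrans (DCompEq (DRefl _) (DMapComp _ _)) _.
  apply: DTrans (DAssoc _ _ _) _.
  by apply: DTrans (DCompEq (DInvl _) (DRefl _)) (DIdl _).
- move=> [c /IHf ac /IHg cb]; apply: DTrans (DSym (DAssoc _ _ _)) _.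
  by apply: DTrans (DCompEq (DRefl _) ac) cb.
Qed.

(** The representing chain map is the image of the identity of [P] under the action. *)
Lemma dhom_full Y (f : dhom P Y) : exists g : chain_map P Y, dhom_eq f (DMap g).
Proof.
have [g fg] := act_total f (chain_id P); exists g.
by apply: DTrans (DSym (DIdr _)) _; exact: act_comp.
Qed.

(** Equal morphisms act equally on the identity of [P], which recovers each map up to homotopy. *)
Lemma dhom_faithful Y (f g : chain_map P Y) : dhom_eq (DMap f) (DMap g) -> htpy f g.
Proof.
move=> /act_dhom_eq fg.
have /fg /= gf : act (DMap f) (chain_id P) f by apply: htpy_ext.
by apply: htpy_sym; apply: htpy_trans gf; exact: htpy_ext.
Qed.

End Action.
End DerivedMaps.

(** * Bounded complexes with finitely generated homology *)

Local Open Scope cat_scope.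

(** [eps] is the counit. By naturality, composing with it is inverse to [adj_to], which gives both
    existence and uniqueness of factorizations. *)
Lemma right_adjoint_counit (C : category) (S : C -> Prop) (X : C) :
  has_right_adjoint (inclusion S) ->
  exists (U : C) (eps : hom U X), [/\ S U,
    forall A, S A -> forall f : hom A X, exists f' : hom A U, eps \oc f' =h f &
    forall A, S A -> forall f g : hom A U, eps \oc f =h eps \oc g -> f =h g].
Proof.
move=> [G [adj]]; pose eps := adj_of adj (idm (G X)).
have to_eps (A : full_sub S) (a : hom A (G X)) :
    adj_to adj (eps \oc (a : @hom C (sval A) (sval (G X)))) =h a.
  have e : eps \oc (a : @hom C (sval A) _) =h
      idm X \oc eps \oc fmap (inclusion S) a.
    by apply: comp_heq (heq_refl _); apply/heq_sym/comp_idl.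
  apply: heq_trans (adj_to_heq adj e) _.
  apply: heq_trans (adj_natural adj _ _ _) _.
  apply: heq_trans (comp_heq (comp_heq (fmap_id G X) (adj_ofK adj _)) (heq_refl a)) _.
  by apply: heq_trans (comp_heq (comp_idl _) (heq_refl a)) (comp_idl _).
exists (sval (G X)), eps; split; first exact: svalP.
- move=> A SA f; exists (adj_to adj (f : hom (inclusion S (exist _ A SA)) X)).
  have e := to_eps (exist _ A SA) (adj_to adj (f : hom (inclusion S (exist _ A SA)) X)).
  apply: heq_trans (heq_sym (adj_toK adj (X := exist _ A SA) _)) _.
  by apply: heq_trans (adj_of_heq adj e) _; exact: adj_toK.
- move=> A SA f g e.
  apply: heq_trans (heq_sym (to_eps (exist _ A SA) f)) _.
  exact: heq_trans (adj_to_heq adj (X := exist _ A SA) e) (to_eps (exist _ A SA) g).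
Qed.

Section QC.
Variable R : comPzRingType.
Implicit Types (L M N P Q U X Y W : complex R).

Lemma homology_map_linear M N (f : chain_map M N) i : linear (@homology_map R M N f i).
Proof.
move=> a h k; have [z ->] := homology_class_surj h.
have [t ->] := homology_class_surj k.
rewrite -linearP !homology_mapE -linearP; congr homology_class.
by apply: val_inj; rewrite /= !linearP.
Qed.

Lemma homology_class_eq0 M i (z : cycle M i) :
  homology_class z = 0 <-> boundary (cycle_val z).
Proof.
have val0 : cycle_val (0 : cycle M i) = 0 by exact: (raddf0 (val : cycle M i -> M i)).
rewrite -(linear0 (@homology_class R M i)) homology_eq val0 subr0.
by [].
Qed.

(** The hypothesis is exactness of homology at [Y], spelled out on cycles. *)
Lemma qc_middle X Y W (u : chain_map X Y) (v : chain_map Y W) :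
  noetherian R ->
  (forall i (y : Y i), cdiff Y i y = 0 -> boundary (v i y) ->
    exists2 x : X i, cdiff X i x = 0 & boundary (y - u i x)) ->
  qc X -> qc W -> qc Y.
Proof.
move=> nR exact_uv [Xfg Xfin] [Wfg Wfin].
have exH i (h : homology Y i) : homology_map v h = 0 ->
    exists k : homology X i, homology_map u k = h.
  have [z ->] := homology_class_surj h; rewrite homology_mapE homology_class_eq0.
  move=> /(exact_uv _ _ (cycle_eq0 z))[x /eqP dx b].
  exists (homology_class (MkCycle (dx : x \in @cycle_pred R X i))).
  by rewrite homology_mapE; apply/esym/homology_eq.
split=> [i|].
  exact: (@fg_middle R _ _ _ (mk_linear (@homology_map_linear X Y u i))
    (mk_linear (@homology_map_linear Y W v i)) nR (@exH i)).
apply: sub_finite_set (_ : finite_set (_ `|` _)%classic).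
  2: by rewrite finite_setU; split; [exact: Xfin|exact: Wfin].
move=> i [h h0]; have [vh|vh] := pselect (homology_map v h = 0); last first.
  by right; exists (homology_map v h); apply/eqP.
left; have [k kh] := exH i h vh; exists k; apply: contra_neq h0 => k0.
by rewrite -kh k0; exact: (linear0 (mk_linear (@homology_map_linear X Y u i))).
Qed.

Lemma qc_quasi_iso X Y (w : chain_map X Y) : noetherian R -> quasi_iso w -> qc Y -> qc X.
Proof.
move=> nR /quasi_isoP wq Yqc.
(* Injectivity of [w] on homology is exactness at [X] with the zero map on the left. *)
apply: (@qc_middle Y X Y (zero_map Y X) w nR) => // i x dx bx.
exists 0; first exact: linear0.
by rewrite /= subr0; exact: (wq i).1.
Qed.

Lemma qc_cone X Y (f : chain_map X Y) : noetherian R -> qc X -> qc Y -> qc (cone f).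
Proof.
move=> nR Xqc Yqc; apply: (qc_middle (u := cone_in f) (v := cone_out f)) => //; last exact: qc_susp.
move=> i [y x] []; have [j ij] := int_pred i; subst i => /= dy _.
move=> /boundary_susp/boundary_predP[c /= xE].
have dy' : cdiff Y (j - 1) (y + f (j - 1) c) = 0.
  by rewrite linearD -cmapP -xE.
exists (y + f (j - 1) c) => //.
apply/boundary_cone; exists 0, (- c) => /=; rewrite /cone_in_fun /=; split.
  by rewrite linear0 linearN; abel.
by rewrite linearN xE; abel.
Qed.

Lemma qc_ext Q U (q : chain_map Q (susp U)) : noetherian R -> qc U -> qc Q -> qc (ext q).
Proof.
move=> nR Uqc Qqc; apply: (qc_middle (u := ext_in q) (v := ext_out q)) => //.
move=> i [u a] []; have [j ij] := int_pred i; subst i => /= du da.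
move=> /boundary_predP[c /= aE].
exists (u - q j c).
  by have /= := cmapP q c; rewrite linearB -aE => <-; rewrite /= in du *; rewrite -du; abel.
apply/boundary_predP; exists ((0, c) : ext q j).
by congr pair; rewrite /= ?linear0 ?aE; abel.
Qed.

Lemma qc_bounded M : qc M -> exists k : int,
  (forall i, i <= - k -> forall x : M i, cdiff M i x = 0 -> boundary x) /\
  (forall i, k <= i -> forall x : M i, cdiff M i x = 0 -> boundary x).
Proof.
move=> [_ /finite_seqP[s sE]].
have null i (x : M i) : i \notin s -> cdiff M i x = 0 -> boundary x.
  move=> /negP nis; apply: (homology_eq0P M i).1 => h; apply: contrapT => /eqP h0.
  apply: nis; have : [set i : int | exists h : homology M i, h != 0]%classic i by exists h.
  by rewrite sE.
pose k := (\sum_(i <- s) `|i| + 1)%N; exists k%:Z.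
have sk i : i \in s -> `|i| < k%:Z.
  by move=> si; rewrite /k (big_rem i) //=; lia.
split=> i ik x; apply: null; apply/negP => /sk; lia.
Qed.

Lemma qc_resolution M : qc M ->
  exists (P : complex R) (w : chain_map P M), bounded_projective P /\ quasi_iso w.
Proof. by move=> /qc_bounded[k [Mk _]]; exact: resolution_exists Mk. Qed.

End QC.

(** * Truncation for an aisle *)

Section DerivedIso.
Variable R : comPzRingType.
Implicit Types (L M N P Q U X Y W : complex R).

Lemma DComp_eql X Y W (g g' : dhom Y W) (f : dhom X Y) :
  dhom_eq g g' -> dhom_eq (DComp g f) (DComp g' f).
Proof. by move=> gg'; apply: DCompEq gg' (DRefl _). Qed.

Lemma DComp_eqr X Y W (g : dhom Y W) (f f' : dhom X Y) :
  dhom_eq f f' -> dhom_eq (DComp g f) (DComp g f').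
Proof. exact: DCompEq (DRefl _). Qed.

Lemma DInv_cancel X Y W (w : chain_map X Y) (qw : quasi_iso w) (f : dhom W X) :
  dhom_eq (DComp (DInv qw) (DComp (DMap w) f)) f.
Proof. by apply: DTrans (DAssoc _ _ _) (DTrans (DComp_eql _ (DInvl _)) (DIdl _)). Qed.

Lemma DMap_cancel X Y W (w : chain_map X Y) (qw : quasi_iso w) (f : dhom W Y) :
  dhom_eq (DComp (DMap w) (DComp (DInv qw) f)) f.
Proof. by apply: DTrans (DAssoc _ _ _) (DTrans (DComp_eql _ (DInvr _)) (DIdl _)). Qed.

Lemma DInv_cancelr X Y W (w : chain_map X Y) (qw : quasi_iso w) (f : dhom X W) :
  dhom_eq (DComp (DComp f (DInv qw)) (DMap w)) f.
Proof.
by apply: DTrans (DSym (DAssoc _ _ _)) (DTrans (DComp_eqr _ (DInvl _)) (DIdr _)).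
Qed.

Lemma DMap_inj X Y W (w : chain_map X Y) (qw : quasi_iso w) (f g : dhom W X) :
  dhom_eq (DComp (DMap w) f) (DComp (DMap w) g) -> dhom_eq f g.
Proof.
move=> e; apply: DTrans (DSym (DInv_cancel qw f)) _.
by apply: DTrans (DComp_eqr _ e) (DInv_cancel qw g).
Qed.

Lemma is_iso_id X : is_iso (DMap (chain_id X) : @hom (derived_cat R) X X).
Proof. by exists (DMap (chain_id X)); split; exact: DIdl. Qed.

Lemma is_iso_DInv X Y (w : chain_map X Y) (qw : quasi_iso w) :
  is_iso (DInv qw : @hom (derived_cat R) Y X).
Proof. by exists (DMap w); split; [exact: DInvr | exact: DInvl]. Qed.

Lemma is_iso_comp (C : category) (X Y W : C) (g : hom Y W) (f : hom X Y) :
  is_iso g -> is_iso f -> is_iso (comp g f).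
Proof.
move=> [g' [g'g gg']] [f' [f'f ff']]; exists (comp f' g'); split.
  apply: heq_trans (heq_sym (comp_assoc _ _ _)) _.
  apply: heq_trans (comp_heq (heq_refl _) (comp_assoc _ _ _)) _.
  apply: heq_trans (comp_heq (heq_refl _) (comp_heq g'g (heq_refl _))) _.
  exact: heq_trans (comp_heq (heq_refl _) (comp_idl _)) f'f.
apply: heq_trans (heq_sym (comp_assoc _ _ _)) _.
apply: heq_trans (comp_heq (heq_refl _) (comp_assoc _ _ _)) _.
apply: heq_trans (comp_heq (heq_refl _) (comp_heq ff' (heq_refl _))) _.
exact: heq_trans (comp_heq (heq_refl _) (comp_idl _)) gg'.
Qed.

End DerivedIso.

Section Aisle.
Variables (R : comPzRingType) (A : Dqc R -> Prop).
Hypotheses (nR : noetherian R) (aisleA : aisle A).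
Implicit Types (L N P Q U X Y W : complex R) (M : Dqc R).

Definition resolves_in P : Prop :=
  bounded_projective P /\
  exists2 M : Dqc R, A M & exists w : chain_map P (sval M), quasi_iso w.

Lemma resolves_in_qc P : resolves_in P -> qc P.
Proof. by move=> [_ [M _ [w qw]]]; exact: qc_quasi_iso nR qw (svalP M). Qed.

Lemma resolves_in_susp P : resolves_in P -> resolves_in (susp P).
Proof.
move=> [Pproj [M AM [w qw]]]; split; first exact: bounded_projective_susp.
exists (tsusp (Dqc R) M); first exact: aisleA.1.1.
by exists (susp_map w); exact: quasi_iso_susp.
Qed.

Lemma quasi_iso_id X : quasi_iso (chain_id X).
Proof.
apply/quasi_isoP => i; split=> // x dx; exists x => //=.
by rewrite subrr; exact: boundary0.
Qed.

(** Aisles are closed under extensions: the triangle on [MU], [ext q] and [MQ] is isomorphic to the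
    cone triangle of [ext_in q]. *)
Lemma resolves_in_ext Q U (q : chain_map Q (susp U)) :
  resolves_in U -> resolves_in Q -> resolves_in (ext q).
Proof.
move=> Ures Qres; split; first exact: bounded_projective_ext Ures.1 Qres.1.
have Eqc := qc_ext q nR (resolves_in_qc Ures) (resolves_in_qc Qres).
have [_ [MU AMU [wU qwU]]] := Ures; have [_ [MQ AMQ [wQ qwQ]]] := Qres.
exists (exist _ (ext q) Eqc : Dqc R); last by exists (chain_id _); exact: quasi_iso_id.
pose c : dhom (sval MQ) (cone (ext_in q)) :=
  DComp (DInv (quasi_iso_ext_quot q)) (DInv qwQ).
pose f : dhom (sval MU) (ext q) := DComp (DMap (ext_in q)) (DInv qwU).
pose g : dhom (ext q) (sval MQ) := DComp (DMap wQ) (DMap (ext_out q)).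
pose h : dhom (sval MQ) (susp (sval MU)) :=
  DComp (DMap (susp_map wU)) (DComp (DMap (cone_out (ext_in q))) c).
apply: (aisleA.1.2 MU (exist _ (ext q) Eqc) MQ f g h) AMU AMQ.
exists U, (ext q), (ext_in q), (DInv qwU), (DMap (chain_id _)), c.
split; split.
- exact: is_iso_DInv.
- exact: is_iso_id.
- by apply: is_iso_comp; exact: is_iso_DInv.
- exact: DIdl.
- apply: DTrans (DSym (DIdr _)).
  apply: DTrans (DSym (DAssoc _ _ _)) _.
  apply: DTrans (DComp_eqr _ (DInv_cancel qwQ _)) _.
  apply: (DMap_inj (quasi_iso_ext_quot q)).
  apply: DTrans (DMap_cancel _ _) _.
  by apply: DTrans (DMapComp _ _); exact: DMapEq.
- exact: DInv_cancel.
Qed.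

(* [cone e] is the truncation of [X] right orthogonal to the aisle. *)
Lemma aisle_orthogonal X : qc X ->
  exists (U : complex R) (e : chain_map U X), [/\ resolves_in U, qc (cone e) &
    forall P (g : chain_map P (cone e)), resolves_in P -> htpy g (zero_map P (cone e))].
Proof.
move=> Xqc.
have [M [eps [AM epsP eps_inj]]] :=
  right_adjoint_counit (exist _ X Xqc : Dqc R) aisleA.2.
have [U [w [Uproj qw]]] := qc_resolution (svalP M).
have Ures : resolves_in U by split=> //; exists M => //; exists w.
have [e eE] := dhom_full Uproj (DComp (eps : dhom (sval M) X) (DMap w)).
(* The universal property of the counit, translated to homotopy classes of chain maps:
   factorizations through [e] exist, and by [factor_inj] they are unique. *)
have factor P (f : chain_map P X) : resolves_in P ->
    exists t : chain_map P U, htpy (chain_comp e t) f.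
  move=> [Pproj [N AN [wN qwN]]].
  have [f' f'E] := epsP N AN (DComp (DMap f) (DInv qwN)).
  have [t tE] := dhom_full Pproj
    (DComp (DInv qw) (DComp (f' : dhom (sval N) (sval M)) (DMap wN))).
  exists t; apply: dhom_faithful Pproj _ _ _ _.
  apply: DTrans (DMapComp _ _) _.
  apply: DTrans (DCompEq (DSym eE) (DSym tE)) _.
  apply: DTrans (DSym (DAssoc _ _ _)) _.
  apply: DTrans (DComp_eqr _ (DMap_cancel _ _)) _.
  apply: DTrans (DAssoc _ _ _) _.
  exact: DTrans (DComp_eql _ f'E) (DInv_cancelr _ _).
have factor_inj P (s t : chain_map P U) : resolves_in P ->
    htpy (chain_comp e s) (chain_comp e t) -> htpy s t.
  move=> [Pproj [N AN [wN qwN]]] /htpy_dhom_eq est.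
  apply: (dhom_faithful Pproj); apply: (DMap_inj qw).
  have epsE (r : chain_map P U) : dhom_eq
      (DComp (eps : dhom (sval M) X) (DComp (DComp (DMap w) (DMap r)) (DInv qwN)))
      (DComp (DMap (chain_comp e r)) (DInv qwN)).
    apply: DTrans (DAssoc _ _ _) _; apply: DComp_eql.
    apply: DTrans (DAssoc _ _ _) _.
    apply: DTrans (DComp_eql _ eE) _; exact: DSym (DMapComp _ _).
  have /(DComp_eql (DMap wN)) st := eps_inj N AN _ _
    (DTrans (epsE s) (DTrans (DComp_eql _ est) (DSym (epsE t)))).
  apply: DTrans (DSym (DInv_cancelr qwN _)) _.
  exact: DTrans st (DInv_cancelr qwN _).
exists U, e; split=> //.
  by apply: qc_cone => //; exact: resolves_in_qc.
move=> P g Pres; pose q := chain_comp (cone_out e) g.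
have qE i x : q i x = (g i x).2 by [].
(* The component of [g] in [X] extends [e] to the extension classified by [q], which is again in the
   aisle. *)
have e'l i : linear (fun z : ext q i => e i z.1 - (g i z.2).1).
  by move=> a u v; rewrite /= !linearP /= ?scalerDr ?scalerN; abel.
have e'P i (z : ext q i) : mk_linear (e'l (i - 1)) (cdiff (ext q) i z) =
    cdiff X i (mk_linear (e'l i) z).
  by rewrite /= cmapP /= linearD linearB -cmapP; abel.
have Eres := resolves_in_ext q Ures Pres.
have [t tE] := factor _ (MkChainMap e'P) Eres.
(* By uniqueness the factorization [t] retracts the extension onto [U] up to homotopy. Hence [q] is
   null-homotopic, [g] comes from [X], and then through [e] from [U], so it vanishes in the cone. *)
have [k kP] : htpy (chain_comp t (ext_in q)) (chain_id U).
  apply: factor_inj => //.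
  apply: htpy_trans _ (htpy_trans (htpy_compr (ext_in q) tE) _).
  - exact: htpy_ext.
  - by apply: htpy_ext => i x /=; rewrite linear0 subr0.
have qnull : htpy q (zero_map P (susp U)).
  have hl i : linear (fun x : P (i - 1) =>
      k (i - 1) (q (i - 1) x) - t (i - 1) ((0, x) : ext q (i - 1)) : susp U i).
    move=> a x y.
    have -> : ((0, a *: x + y) : ext q (i - 1)) = a *: ((0, x) : ext q (i - 1)) + (0, y).
      by congr pair; rewrite /= scaler0 addr0.
    by rewrite !linearP /= ?scalerDr ?scalerN; abel.
  exists (fun i => mk_linear (hl i)) => i x.
  have tq : t (i - 1 - 1) ((q (i - 1) x, 0) : ext q (i - 1 - 1)) +
      t (i - 1 - 1) ((0, cdiff P (i - 1) x) : ext q (i - 1 - 1)) =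
      cdiff U (i - 1) (t (i - 1) ((0, x) : ext q (i - 1))).
    rewrite -cmapP -linearD; congr (t _ _).
    by congr pair; rewrite /= ?linear0; abel.
  have /= kq := kP (i - 1) (q (i - 1) x : U (i - 1 - 1)).
  have /= qd := cmapP q x.
  rewrite /= in tq *; rewrite linearB -tq qd linearN subr0.
  apply: (addrI (- t (i - 1 - 1) (q (i - 1) x, 0))).
  transitivity (- (t (i - 1 - 1) (q (i - 1) x, 0) - q (i - 1) x)); last by abel.
  by rewrite -kq /=; abel.
have [g' gg'] := htpy_cone_in qnull.
have [s sg'] := factor _ g' Pres.
apply: htpy_trans gg' _; apply: htpy_trans (htpy_compl (cone_in e) (htpy_sym sg')) _.
apply: htpy_trans (htpy_trans (htpy_compr s (htpy_cone_in0 e)) _); exact: htpy_ext.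
Qed.

End Aisle.

(** * Supports *)

Section Support.
Variable R : comPzRingType.
Implicit Types (M P W : complex R) (q : Spec R).

(* [q] lies in the support of [homology M j]. *)
Definition supp q M (j : int) : Prop :=
  exists2 z : M j, cdiff M j z = 0 & forall s, boundary (s *: z) -> s \in q.

Lemma not_supp q M j : ~ supp q M j <->
  forall z : M j, cdiff M j z = 0 -> exists2 s, s \notin q & boundary (s *: z).
Proof.
split=> [nsupp z dz|h [z dz zq]]; last first.
  by have [s /negP sq /zq] := h z dz.
apply: contrapT => h; apply: nsupp; exists z => // s bs.
by apply: contraT => sq; case: h; exists s.
Qed.

Lemma supp_susp q M j : supp q (susp M) j <-> supp q M (j - 1).
Proof.
split=> -[z dz zq]; exists z.
- by apply/eqP; rewrite -oppr_eq0; apply/eqP.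
- by move=> s b; apply: zq; apply/boundary_susp.
- by rewrite /= dz oppr0.
- by move=> s /boundary_susp; exact: zq.
Qed.

Lemma supp_iter_susp q M m j : supp q (iter m (@susp R) M) j <-> supp q M (j - m%:Z).
Proof.
elim: m j => [|m IHm] j; first by rewrite subr0.
rewrite iterS supp_susp IHm; have -> : j - 1 - m%:Z = j - m.+1%:Z by lia.
by [].
Qed.

Lemma supp_homology q M j (z : cycle M j) :
  (forall s, boundary (s *: cycle_val z) -> s \in q) ->
  forall s, s *: homology_class z = 0 -> s \in q.
Proof.
by move=> zq s; rewrite -linearZ /= homology_class_eq0 => b; exact: zq.
Qed.

(** The product of denominators chosen for finitely many generators kills the whole homology
    module. *)
Lemma uniform_annihilator q M j :
  finitely_generated (homology M j) -> ~ supp q M j ->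
  exists2 t, t \notin q & forall z : M j, cdiff M j z = 0 -> boundary (t *: z).
Proof.
move=> /homology_fgP[m [g [dg gP]]] /not_supp nq.
have sg k : exists s, s \notin q /\ boundary (s *: g k).
  by have [s ? ?] := nq _ (dg k); exists s.
have [s sP] := choice sg; pose t := \prod_k s k; exists t.
  by apply: spec_prod => k; have [] := sP k.
move=> z dz; have [c b] := gP z dz.
rewrite -(subrK (\sum_k c k *: g k) z) scalerDr; apply: boundaryD; first exact: boundaryZ.
rewrite scaler_sumr; elim/big_rec: _ => [|k x _ bx]; first exact: boundary0.
apply: boundaryD => //; rewrite scaler_swap; apply: boundaryZ.
by rewrite /t (bigD1 k) //= mulrC -scalerA; apply: boundaryZ; have [] := sP k.
Qed.

(** Localized at [q], [P] is exact below degree [i], hence contractible there. Since [P] is bounded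
    below, finitely many denominators, multiplied into [t], turn the contraction into maps over
    [R]. *)
Lemma partial_contraction q P i :
  bounded_projective P -> (forall j, finitely_generated (homology P j)) ->
  (forall j, j < i -> ~ supp q P j) ->
  exists2 t, t \notin q & exists h : {linear P (i - 1) -> P i},
    forall u, cdiff P (i - 1) u = 0 -> cdiff P i (h u) = t *: u.
Proof.
move=> [Pproj [k Pk]] Pfg nq.
have : forall (m : nat) (j : int), j <= k + m%:Z -> j <= i ->
  exists2 t, t \notin q & exists h : {linear P (j - 1) -> P j},
    forall u, cdiff P (j - 1) u = 0 -> cdiff P j (h u) = t *: u; last first.
  by move=> /(_ `|i - k|%N i); apply; lia.
elim=> [|m IHm] j jm ji.
  exists 1; first exact: spec1.
  exists \0 => u _; rewrite (Pk _ _ u) ?linear0 ?scaler0 //; lia.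
have [||t tq [h hP]] := IHm (j - 1); [lia|lia|].
have [|t' t'q t'P] := uniform_annihilator (Pfg (j - 1)) (nq (j - 1) _); first lia.
have fl : linear (fun x : P (j - 1) => t' *: (t *: x - h (cdiff P (j - 1) x))).
  by move=> a x y; rewrite !linearP /= (scaler_swap t a); abel.
have [|h' h'P] := Pproj (j - 1) _ _ (cdiff P j) (mk_linear fl) _.
  move=> x; have /boundary_predP[y yE] :
      boundary (t' *: (t *: x - h (cdiff P (j - 1) x))).
    by apply: t'P; rewrite linearB linearZ /= hP ?cdiffK ?subrr.
  by exists y.
exists (t' * t); first by rewrite specM negb_or t'q.
by exists h' => u du; rewrite h'P /= du linear0 subr0 scalerA.
Qed.

Lemma family_at (T : int -> Type) (d : forall j, T j) (i : int) (x : T i) :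
  exists z : forall j, T j, z i = x /\ forall j, j <> i -> z j = d j.
Proof.
exists (fun j => if pselect (i = j) is left e then ecast l (T l) e x else d j).
split=> [|j ji]; case: pselect => // e; last by case: ji.
by rewrite (eq_irrelevance e erefl).
Qed.

(** A nonzero form from the lowest [q]-local homology of [P] to R/q, identified with the multiples
    of the class of [e], lifts to a chain map: projectivity lifts it in degree [i], zero serves
    below, and exactness of [W] above [i] extends it upwards. *)
Lemma nonnull_map q P W i (e : W i) :
  bounded_projective P -> (forall j, finitely_generated (homology P j)) ->
  (forall j, j < i -> ~ supp q P j) -> supp q P i ->
  (forall j, i < j -> forall x : W j, cdiff W j x = 0 -> boundary x) ->
  cdiff W i e = 0 -> (forall s, boundary (s *: e) <-> s \in q) ->
  exists f : chain_map P W, ~ htpy f (zero_map P W).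
Proof.
move=> Pbp Pfg nq [z0 dz0 z0q] Wi /eqP de eq_.
have [t tq [h hP]] := partial_contraction Pbp Pfg nq.
have [rho [rhoP [h0 h0q]]] := local_functional (Pfg i)
  (@supp_homology q P i (MkCycle (introT eqP dz0 : z0 \in @cycle_pred R P i)) z0q).
have [z1 h0E] := homology_class_surj h0.
pose ec : cycle W i := MkCycle (de : e \in @cycle_pred R W i).
have rho0 := linear_mod0 rhoP.
have eann s : s \in q -> s *: homology_class ec = 0.
  by move=> /eq_ b; rewrite -linearZ /=; apply/homology_class_eq0; exact: b.
have rho_lin a u v :
    rho (a *: u + v) *: homology_class ec =
    a *: (rho u *: homology_class ec) + rho v *: homology_class ec.
  apply/eqP; rewrite scalerA -scalerDl -subr_eq0 -scalerBl; apply/eqP.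
  exact: eann.
(* The partial contraction gives a map of degree [i] chains to cycles that multiplies cycles by [t],
   so a form on homology extends to all of [P i]. *)
have Yc x : (t *: x - h (cdiff P i x)) \in @cycle_pred R P i.
  by rewrite inE linearB linearZ /= hP ?cdiffK ?subrr.
have Yl : linear (fun x => MkCycle (Yc x)).
  move=> a x y; apply: val_inj; rewrite /= !linearP /= (scaler_swap t a).
  by abel.
have psil : linear (fun x => rho (homology_class (mk_linear Yl x)) *: homology_class ec).
  by move=> a x y; rewrite !linearP rho_lin.
have [|phi phiP] := Pbp.1 i _ _ (@homology_class R W i : {linear _ -> _}) (mk_linear psil) _.
  by move=> x; have [z ->] := homology_class_surj (mk_linear psil x); exists z.
have vl : linear (fun x => cycle_val (phi x)) by move=> a x y; rewrite linearP.
have [z [zi z0']] := @family_at (fun j => {linear P j -> W j}) (fun j => \0) i (mk_linear vl).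
pose T (j : int) := {linear P j -> W j}.
(* Preserving boundaries is what allows the next lift through the differential of [W]. *)
pose good j (a : T j) := forall u, boundary u -> boundary (a u).
pose rel j (a : T (j - 1)) (b : T j) := forall x : P j, cdiff W j (b x) = a (cdiff P j x).
have [|||f [fz fgood frel]] := @dependent_choice_int T good rel z i.
- move=> j ji u bu; have [ij|/z0' ->] := pselect (j = i); last exact: boundary0.
  subst j; rewrite zi /=; apply/homology_class_eq0; rewrite phiP /=.
  have -> : MkCycle (Yc u) = t *: MkCycle (introT eqP (boundary_cycle bu)).
    by apply: val_inj; rewrite /= (boundary_cycle bu) linear0 subr0.
  rewrite linearZ /= (homology_class_eq0 (MkCycle _)).2 // scaler0; apply: eann.
  exact: rho0.
- move=> j ji x; have [ij|ij] := pselect (j = i).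
    by subst j; rewrite (z0' (i - 1)) ?zi /= ?cycle_eq0 //; lia.
  by rewrite (z0' j) // (z0' (j - 1)) ?linear0 //; lia.
- move=> j a ij ga.
  have [|b bP] := Pbp.1 j _ _ (cdiff W j) (a \o cdiff P j) _.
    by move=> x; have /boundary_predP[y] := ga _ (Boundary x); exists y.
  exists b; split=> // u /boundary_cycle du; apply: Wi => //.
  by rewrite bP /= du linear0.
exists (MkChainMap (fun j x => esym (frel j x))) => /htpy_boundary.
move=> /(_ i (cycle_val z1) (cycle_eq0 z1)) /=.
(* The value at [z1] has class [rho (t *: h0)] times that of [e]. A null-homotopic map would put
   this scalar in [q], although modulo [q] it is [t * rho h0], a product of elements outside [q]. *)
rewrite subr0 (fz i (lexx i)) zi /= => /homology_class_eq0; rewrite phiP /=.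
have -> : MkCycle (Yc (cycle_val z1)) = t *: z1.
  by apply: val_inj; rewrite /= cycle_eq0 linear0 subr0.
rewrite linearZ /= -h0E -linearZ /= homology_class_eq0 => /eq_ rq.
have := rhoP t h0 0; rewrite addr0 => /(specB rq); rewrite subKr => trq.
have : t * rho h0 \in q by rewrite -[t * _](addrK (rho 0)) specB // rho0.
by rewrite specM (negbTE tq) (negbTE h0q).
Qed.

End Support.

(** * Iterated cones of multiplications *)

Section Koszul.
Variable R : comPzRingType.
Implicit Types (P W : complex R) (p q : Spec R) (a : R).

Fact mul_map_linear W a i : linear (fun x : W i => a *: x).
Proof. by move=> r x y; rewrite scalerDr scaler_swap. Qed.

Fact mul_map_subproof W a i (x : W i) :
  mk_linear (@mul_map_linear W a (i - 1)) (cdiff W i x) =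
  cdiff W i (mk_linear (@mul_map_linear W a i) x).
Proof. by rewrite /= linearZ. Qed.

Definition mul_map W a : chain_map W W :=
  @MkChainMap R W W (fun i => mk_linear (@mul_map_linear W a i)) (@mul_map_subproof W a).

(** The Koszul complex on [s] with coefficients in [W], up to signs; the head of the list gives the
    outermost cone and can be removed first. *)
Definition koszul (s : seq R) W : complex R :=
  foldr (fun a W => cone (mul_map W a)) W s.

Definition null_mul a W : Prop := htpy (mul_map W a) (zero_map W W).

Lemma null_mul_boundary a W i (x : W i) :
  null_mul a W -> cdiff W i x = 0 -> boundary (a *: x).
Proof. by move=> aW dx; have := htpy_boundary aW dx; rewrite /= subr0. Qed.

Lemma null_mul_comb a b r W : null_mul a W -> null_mul b W -> null_mul (r * a + b) W.
Proof.
move=> [h hP] [k kP].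
have l i : linear (fun x : W (i - 1) => r *: h i x + k i x).
  by move=> c x y; rewrite !linearP /= (scaler_swap r c); abel.
exists (fun i => mk_linear (l i)) => i x; have /= := hP i x; have /= := kP i x.
rewrite !subr0 scalerDl -scalerA => <- <-.
by rewrite linearD linearZ /= scalerDr; abel.
Qed.

Lemma null_mul_sum m (c g : 'I_m -> R) W :
  (forall i, null_mul (g i) W) -> null_mul (\sum_i c i * g i) W.
Proof.
move=> gW; elim/big_rec: _ => [|i a _ aW]; last exact: null_mul_comb.
by apply: htpy_ext => i x /=; rewrite scale0r.
Qed.

Lemma null_mul_self a W : null_mul a (cone (mul_map W a)).
Proof.
have l i : linear (fun z : cone (mul_map W a) (i - 1) => (0, z.1) : cone (mul_map W a) i).
  by move=> r x y; congr pair; rewrite /= scaler0 addr0.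
exists (fun i => mk_linear (l i)) => i [x y] /=; congr pair => /=.
  by rewrite linear0; abel.
by abel.
Qed.

Lemma null_mul_cone a b W : null_mul a W -> null_mul a (cone (mul_map W b)).
Proof.
move=> [h hP].
have l i : linear (fun z : cone (mul_map W b) (i - 1) =>
    (h i z.1, - h (i - 1) z.2) : cone (mul_map W b) i).
  by move=> r x y; rewrite /= !linearP.
exists (fun i => mk_linear (l i)) => i [x y] /=.
have /= hx := hP i x; have /= hy := hP (i - 1) y; congr pair => /=.
  by rewrite -hx linearD linearZ /= scalerN; abel.
by rewrite -hy !linearN /=; abel.
Qed.

Lemma null_mul_koszul a s W : a \in s -> null_mul a (koszul s W).
Proof.
elim: s => //= b s IHs; rewrite inE => /predU1P[->|/IHs]; first exact: null_mul_self.
exact: null_mul_cone.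
Qed.

Lemma qc_koszul s W : noetherian R -> qc W -> qc (koszul s W).
Proof. by move=> nR Wqc; elim: s => //= a s IHs; exact: qc_cone. Qed.

(* [p] is an associated prime of [homology W j], witnessed by a cycle that is
   strictly, not only up to boundaries, annihilated by [p]. *)
Definition strict_ass p W (j : int) : Prop :=
  exists c : W j, [/\ cdiff W j c = 0, forall a, a \in p -> a *: c = 0 &
    forall a, boundary (a *: c) -> a \in p].

(** The witness is [(0, c)], placed one degree higher; it is a cycle because [a] kills [c] itself
    and not only its class. *)
Lemma strict_ass_cone p W j a :
  a \in p -> strict_ass p W (j - 1) -> strict_ass p (cone (mul_map W a)) j.
Proof.
move=> ap [c [dc cp bc]]; exists (0, c); split.
- by congr pair; rewrite /= ?dc ?oppr0 // cp // linear0 addr0.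
- by move=> b /cp bc0; congr pair; rewrite /= ?bc0 ?scaler0.
- have [k kj] := int_pred j; subst j => b /boundary_cone[y [x [_ /= bE]]].
  by apply: bc; rewrite bE; apply: boundaryN; exact: Boundary.
Qed.

Lemma strict_ass_koszul p W j s : {subset s <= p} ->
  strict_ass p W j -> strict_ass p (koszul s W) (j + (size s)%:Z).
Proof.
move=> sp Wj; elim: s sp => [|a s IHs] sp /=; first by rewrite addr0.
apply: strict_ass_cone; first by apply: sp; rewrite mem_head.
have -> : j + (size s).+1%:Z - 1 = j + (size s)%:Z by lia.
by apply: IHs => b bs; apply: sp; rewrite inE bs orbT.
Qed.

(** Nakayama: vanishing of the cone at [q] makes multiplication by [a] locally onto in degree [j],
    while a linear form to R/q kills multiples of [a]. *)
Lemma supp_cone_surj q W a j : finitely_generated (homology W j) -> a \in q ->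
  ~ supp q (cone (mul_map W a)) j -> ~ supp q W j.
Proof.
move=> Wfg aq /not_supp nq [z dz zq].
have [rho [rhoP [h0 h0q]]] := local_functional Wfg
  (@supp_homology R q W j (MkCycle (introT eqP dz : z \in @cycle_pred R W j)) zq).
have [z1 h0E] := homology_class_surj h0.
have [|s sq b] := nq (cycle_val z1, 0).
  by congr pair; rewrite /= ?cycle_eq0 ?linear0 ?scaler0 ?addr0 ?oppr0.
have [x [y [dy bE]]] : exists x (y : cycle W j),
    boundary x /\ s *: cycle_val z1 = x + a *: cycle_val y.
  have [i ij] := int_pred j; subst j; move: b => /boundary_cone[u [v [/= e1 e2]]].
  have dv : v \in @cycle_pred R W (i - 1).
    by rewrite inE -oppr_eq0 -e2 scaler0.
  by exists (cdiff W i u), (MkCycle dv); split; [exact: Boundary|].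
have rho0 := linear_mod0 rhoP.
have rhoZ c h : rho (c *: h) - c * rho h \in q.
  by have := specD (rhoP c h 0) rho0; rewrite addr0 opprD addrA subrK.
have e : s *: h0 = a *: homology_class y.
  by rewrite h0E -!linearZ /=; apply/homology_eq; rewrite /= bE addrK.
have : s * rho h0 \in q.
  have := specB (rhoZ a (homology_class y)) (rhoZ s h0); rewrite -e opprB.
  rewrite addrC addrA subrK => h.
  by rewrite -(subrK (a * rho (homology_class y)) (s * _)) specD // specMr.
by rewrite specM (negbTE sq) (negbTE h0q).
Qed.

(** Vanishing of the cone in degree [j + 1] makes [a] locally injective on homology in degree [j].
    Being locally nilpotent there as well, it forces that homology to vanish, so the bound drops
    with the length of the list. *)
Lemma supp_cone_nil q W a (N : int) :
  (exists (t : R) (m : nat), t \notin q /\ null_mul (t * a ^+ m) W) ->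
  (forall j, N + 1 <= j -> ~ supp q (cone (mul_map W a)) j) ->
  forall j, N <= j -> ~ supp q W j.
Proof.
move=> [t [m [tq tam]]] nq j Nj; apply/not_supp => z dz.
have step s (y : W j) : cdiff W j y = 0 -> s \notin q -> boundary (s *: (a *: y)) ->
    exists2 s', s' \notin q & boundary (s' *: y).
  have [i ij] := int_pred j; subst j => dy sq /boundary_predP[u uE].
  (* If [u] bounds [s *: (a *: y)], then [(- u, s *: y)] is a cycle of the cone one degree up. *)
  have [||s' s'q] := (not_supp q _ i).1 (nq i _) (- u, s *: y).
  - by lia.
  - congr pair => /=; last by rewrite linearZ /= dy scaler0 oppr0.
    by rewrite linearN -uE scaler_swap addNr.
  have [k ki] := int_pred i; subst i => /boundary_cone[u' [v' [_ /= e]]].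
  exists (s' * s); first by rewrite specM negb_or s'q.
  by rewrite -scalerA e; apply: boundaryN; exact: Boundary.
have : boundary (t *: (a ^+ m *: z)) by rewrite scalerA; exact: null_mul_boundary.
elim: m t tq {tam} => [|m IHm] t tq; first by rewrite expr0 scale1r => b; exists t.
rewrite exprS -scalerA => /(step t (a ^+ m *: z)) [||s sq bs] //.
  by rewrite linearZ /= dz scaler0.
exact: IHm bs.
Qed.

End Koszul.

(** * The theorem *)

Section Main.
Variables (R : comPzRingType) (A : Dqc R -> Prop).
Hypotheses (nR : noetherian R) (aisleA : aisle A).
Implicit Types (P W : complex R) (p q : Spec R) (a : R).

Definition orthogonal (r : nat) W : Prop :=
  forall P, resolves_in A P ->
  forall f : chain_map (iter r (@susp R) P) W, htpy f (zero_map _ W).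

(** The component in [susp W] is null after desuspension, so the map comes from [W]. There it is
    null because one suspension can be absorbed into the aisle. *)
Lemma orthogonal_cone r a W :
  orthogonal r W -> orthogonal r.+1 (cone (mul_map W a)).
Proof.
move=> Wr P Pres f.
have Wr' (g : chain_map (iter r.+1 (@susp R) P) W) : htpy g (zero_map _ W).
  by move: g; rewrite iterSr; apply: Wr; exact: resolves_in_susp.
have [g fg] := htpy_cone_in (htpy_desusp (chain_comp (cone_out (mul_map W a)) f) (Wr P Pres)).
apply: htpy_trans fg (htpy_trans (htpy_compl _ (Wr' g)) _).
by apply: htpy_ext => i x; rewrite /= /cone_in_fun.
Qed.

Lemma orthogonal_koszul s W : orthogonal 0 W -> orthogonal (size s) (koszul s W).
Proof. by move=> W0; elim: s => //= a s; exact: orthogonal_cone. Qed.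

Lemma resolves_in_iter P m : resolves_in A P -> resolves_in A (iter m (@susp R) P).
Proof. by move=> Pres; elim: m => //= m; exact: resolves_in_susp. Qed.

Lemma supp_least q P (n : int) : bounded_projective P -> supp q P n ->
  exists k, [/\ k <= n, supp q P k & forall j, j < k -> ~ supp q P j].
Proof.
move=> [_ [b Pb]] qn.
have low j : j <= b -> ~ supp q P j.
  move=> jb [z _ /(_ 1)]; rewrite (Pb _ jb z) scaler0 => /(_ (boundary0 _ _)).
  by apply/negP; exact: spec1.
have bn : b <= n by case: leP => // nb; case: (low n) => //; exact: ltW.
have ex : exists m : nat, `[< supp q P (b + m%:Z) >].
  by exists `|n - b|%N; apply/asboolP; have -> : b + `|n - b|%N%:Z = n by lia.
case: (ex_minnP ex) => m /asboolP qm mmin; exists (b + m%:Z); split=> //.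
  have : (m <= `|n - b|)%N.
    by apply: mmin; apply/asboolP; have -> : b + `|n - b|%N%:Z = n by lia.
  lia.
move=> j jm qj; have bj : b <= j by case: leP => // jb; case: (low j) => //; exact: ltW.
have : (m <= `|j - b|)%N.
  by apply: mmin; apply/asboolP; have -> : b + `|j - b|%N%:Z = j by lia.
lia.
Qed.

(** Descending induction from a degree above which [W] is acyclic: a class in the top remaining
    degree yields, by [nonnull_map], a map forbidden by orthogonality. *)
Lemma orthogonal_vanish p P W r (n : int) :
  resolves_in A P -> supp p P n -> orthogonal r W -> qc W ->
  (forall a, a \in p -> null_mul a W) ->
  forall j, n + r%:Z <= j -> forall x : W j, cdiff W j x = 0 -> boundary x.
Proof.
move=> Pres [z dz zp] Wr Wqc pW; have [k [_ Wk]] := qc_bounded Wqc.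
have : forall (m : nat) j, n + r%:Z <= j -> k - m%:Z <= j ->
    forall x : W j, cdiff W j x = 0 -> boundary x; last first.
  by move=> h j nj; apply: (h `|k - j|%N j nj); lia.
elim=> [|m IHm] j nj kj; first by apply: Wk; lia.
move=> x dx; apply: contrapT => nbx.
pose xc : cycle W j := MkCycle (introT eqP dx : x \in @cycle_pred R W j).
have [|||q [b [qE _]]] := @prime_annihilator R (homology W j) (eq 1) (homology_class xc) nR.
- by [].
- by move=> u v <- <-; rewrite mulr1.
- by move=> s <-; rewrite scale1r => /homology_class_eq0.
have eq_ s : boundary (s *: (b *: x)) <-> s \in q.
  have bc : homology_class (s *: (b *: xc)) = s *: (b *: homology_class xc).
    by rewrite linearZ /= linearZ.
  rewrite qE -bc; split=> [bx|/eqP/homology_class_eq0 //].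
  by apply/eqP/homology_class_eq0.
have dbx : cdiff W j (b *: x) = 0 by rewrite linearZ /= dx scaler0.
have pq a : a \in p -> a \in q.
  by move=> ap; apply/eq_; apply: null_mul_boundary => //; exact: pW.
(* The support grows along inclusions of primes, so [q] occurs in degree [n]; its lowest degree [l]
   may be smaller. *)
have [l [ln ql qmin]] : exists l, [/\ l <= n, supp q P l & forall i, i < l -> ~ supp q P i].
  by apply: (supp_least Pres.1); exists z => // c /zp /pq.
(* From [l <= n] and [n + r <= j], the shift aligning degrees [l] and [j] is at least [r], as
   orthogonality requires. *)
pose m' := `|j - l|%N; have m'E : j = l + m'%:Z by rewrite /m'; lia.
pose Q := iter m' (@susp R) P.
have Qres : resolves_in A Q by exact: resolves_in_iter.
have [f] : exists f : chain_map Q W, ~ htpy f (zero_map Q W).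
  apply: (nonnull_map Qres.1 (resolves_in_qc nR Qres).1 _ _ _ dbx eq_).
  - by move=> i ij /supp_iter_susp; apply: qmin; lia.
  - by apply/supp_iter_susp; have -> : j - m'%:Z = l by lia.
  - by move=> i ji; apply: IHm; lia.
apply; have m'r : m' = (r + (m' - r))%N by lia.
move: f; rewrite /Q m'r iterD; apply: Wr; exact: resolves_in_iter.
Qed.

End Main.

(** If no such relation existed, a prime containing [p] and [x] would avoid all [t * y ^+ m] with
    [t] outside [p']. It would lie inside [p'], miss [y], and so be strictly between [p] and
    [p']. *)
Lemma maximal_under_radical (R : comPzRingType) (p p' : Spec R) (x y : R) :
  noetherian R -> maximal_under p p' -> x \in p' -> x \notin p -> y \in p' ->
  exists (t : R) (m : nat) (r c : R),
    [/\ t \notin p', c \in p & t * y ^+ m = r * x + c].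
Proof.
move=> nR [pp' _ pmax] xp' xp yp'; apply: contrapT => nex.
pose I : {pred R^o} := [pred s : R | `[< exists r c, c \in p /\ s = r * x + c >]].
pose S s := exists (t : R) (m : nat), t \notin p' /\ s = t * y ^+ m.
have [||||q [Iq Sq]] := @prime_avoiding R I S nR.
- split=> [|a u v]; first by apply/asboolP; exists 0, 0; rewrite spec0 mul0r addr0.
  move=> /asboolP[r [c [cp ->]]] /asboolP[r' [c' [c'p ->]]]; apply/asboolP.
  exists (a * r + r'), (a * c + c'); split; first exact: specZD.
  by rewrite [_ *: _]mulrDr mulrDl mulrA; abel.
- by exists 1, 0%N; rewrite mul1r spec1.
- move=> _ _ [t [m [tp ->]]] [t' [m' [t'p ->]]]; exists (t * t'), (m + m')%N.
  by rewrite specM negb_or tp t'p exprD mulrACA.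
- move=> _ [t [m [tp ->]]]; apply/negP => /asboolP[r [c [cp e]]].
  by apply: nex; exists t, m, r, c.
apply: pmax; exists q; split.
- by move=> c cp; apply: Iq; apply/asboolP; exists 0, c; rewrite mul0r add0r.
- move=> qp; move/negP: xp; apply; apply: qp; apply: Iq; apply/asboolP.
  by exists 1, 0; rewrite spec0 mul1r addr0.
- move=> s sq; apply: contraLR sq => sp'; apply: Sq.
  by exists s, 0%N; rewrite mulr1.
- have /negP yq : y \notin q by apply: Sq; exists 1, 1%N; rewrite spec1 mul1r.
  by move/(_ y yp').
Qed.

Lemma concentrated_cyclic (R : comPzRingType) (p : Spec R) (n : int) :
  exists (X : complex R) (x : X n), [/\ qc X, forall i (y : X i), cdiff X i y = 0 &
    forall a, (a *: x = 0) <-> a \in p].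
Proof.
(* The ideal is [p] in degree [n] and the whole ring elsewhere, so one quotient construction serves
   all degrees. *)
pose I (j : int) : {pred R^o} := [pred s : R | (j == n) ==> (s \in p)].
have Icl j : submod_closed (I j).
  split=> [|a u v]; rewrite !inE; case: (j == n) => //=; first exact: spec0.
  exact: specZD.
have [Q QP] : exists Q : int -> lmodType R, forall j, exists pi : {linear R^o -> Q j},
    (forall x, (pi x == 0) = (x \in I j)) /\ forall y, exists x, pi x = y.
  by have [Q QP] := choice (fun j => quotient_exists (Icl j)); exists Q.
pose X := @MkComplex R Q (fun j => \0) (fun j y => erefl).
have [pi [piE pi_surj]] := QP n.
have pi1 a : pi (a : R^o) = a *: pi 1 by rewrite -linearZ /= [_ *: _]mulr1.
exists X, (pi 1); split=> //; last first.
  move=> a; rewrite -pi1; split=> [/eqP|ap]; first by rewrite piE inE eqxx.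
  by apply/eqP; rewrite piE inE eqxx.
split=> [i|].
  apply/homology_fgP; have [pj [_ pj_surj]] := QP i.
  exists 1%N, (fun=> pj 1); split=> // x _; have [a <-] := pj_surj x.
  exists (fun=> a); rewrite big_ord1 -linearZ /= [a *: _]mulr1 subrr.
  exact: boundary0.
apply: sub_finite_set (finite_set1 n) => i [h h0]; apply: contrapT => ni.
move/eqP: h0; apply; apply: (homology_eq0P X i).2 => x _.
have [pj [pjE pj_surj]] := QP i; have [a ax] := pj_surj x.
have -> : x = 0; last exact: boundary0.
by apply/eqP; rewrite -ax pjE inE /=; case: eqP ni.
Qed.

(** Over a noetherian ring the closure of the associated primes is the support; quasi-isomorphisms
    carry the support over to resolutions. *)
Lemma phi_supp (R : comPzRingType) (A : Dqc R -> Prop) (n : int) (p : Spec R) :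
  noetherian R -> phi A n p <-> exists2 P, resolves_in A P & supp p P n.
Proof.
move=> nR; split=> [[M AM [q [h hq] qp]]|[P [Pbp [M AM [w qw]]] [z dz zp]]].
  have [P [w [Pbp qw]]] := qc_resolution (svalP M).
  exists P; first by split=> //; exists M => //; exists w.
  have [z hz] := homology_class_surj h.
  have [_ /(_ _ (cycle_eq0 z))[y dy b]] := (quasi_isoP w).1 qw n.
  exists y => // s bs; apply: qp; rewrite hq hz -linearZ /=; apply/eqP.
  apply/homology_class_eq0; rewrite -[cycle_val _]/(s *: cycle_val z).
  have -> : s *: cycle_val z = w n (s *: y) - s *: (w n y - cycle_val z).
    by rewrite linearZ /= scalerBr opprB addrC subrK.
  by apply: boundaryB; [exact: boundary_map | exact: boundaryZ].
have dwz : cdiff (sval M) n (w n z) = 0 by rewrite -cmapP dz linear0.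
pose zc : cycle (sval M) n := MkCycle (introT eqP dwz : _ \in @cycle_pred R _ n).
have [|||q [r [qE qp]]] := @prime_annihilator R _ (fun s => s \notin p) (homology_class zc) nR.
- exact: spec1.
- by move=> u v up vp; rewrite specM negb_or up.
- move=> s sp; rewrite -linearZ => /homology_class_eq0 /=; rewrite -linearZ => b.
  move/negP: sp; apply; apply: zp; have [w1 _] := (quasi_isoP w).1 qw n.
  by apply: w1 => //; rewrite linearZ /= dz scaler0.
exists M => //; exists q; first by exists (r *: homology_class zc).
by move=> s sq; apply: contraT => /qp; rewrite sq.
Qed.

Lemma spec_generators (R : comPzRingType) (q : Spec R) : noetherian R ->
  exists s : seq R, {subset s <= q} /\
    forall W, (forall a, a \in s -> null_mul a W) -> forall a, a \in q -> null_mul a W.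
Proof.
move=> nR; have [m [g gP]] := nR _ (spec_ideal q); exists (codom g); split.
  move=> _ /codomP[i ->]; apply/gP; exists (fun j => (j == i)%:R).
  rewrite (bigD1 i) //= eqxx mul1r big1 ?addr0 // => j /negbTE ->.
  by rewrite mul0r.
move=> W gW a /gP[c ->]; apply: null_mul_sum => i; exact/gW/codom_f.
Qed.

Theorem theoremB (R : comPzRingType) (A : Dqc R -> Prop) (n : int)
    (p p' : Spec R) :
  noetherian R -> aisle A -> phi A n p' -> maximal_under p p' ->
  phi A (n + 1) p.
Proof.
move=> nR aisleA /(phi_supp _ _ _ nR)[P Pres p'P] pmax; apply: contrapT => npA.
have [pp' /existsNP[x /not_implyP[xp' /negP xp]] _] := pmax.
have [X [x1 [Xqc dX x1E]]] := concentrated_cyclic p (n + 1).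
have [U [e [Ures Vqc Vorth]]] := aisle_orthogonal nR aisleA Xqc.
pose V := cone e.
(* If [a] kills the class of the generator of R/p in [V], then [a *: x1] comes from a cycle of [U]
   in degree [n + 1]. By assumption some [s] outside [p] kills its class, so [s * a], and then [a],
   is in [p]. *)
have Vass : strict_ass p V (n + 1).
  exists (x1, 0); split.
  - by congr pair; rewrite /= ?dX ?linear0 ?addr0 ?oppr0.
  - by move=> a /x1E ax; congr pair; rewrite /= ?ax ?scaler0.
  move=> a; have [k kn] := int_pred (n + 1); rewrite kn in x1 x1E *.
  move=> /boundary_cone[y [u [/=]]]; rewrite dX add0r scaler0 => ax /eqP.
  rewrite eq_sym oppr_eq0 => /eqP du.
  have [|s sp /boundary_predP[v vE]] := (not_supp p U (k - 1)).1 _ u du.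
    by move=> pU; apply: npA; apply/(phi_supp _ _ _ nR); exists U; rewrite // kn.
  have : s * a \in p by apply/x1E; rewrite -scalerA ax -linearZ vE cmapP dX.
  by rewrite specM (negbTE sp).
have [s [sp s_null]] := spec_generators p nR.
have [s' [s'p s'_null]] := spec_generators p' nR.
have vanish j : n + (size (s' ++ x :: s))%:Z <= j ->
    ~ supp p' (koszul (s' ++ x :: s) V) j.
  move=> nj; apply/not_supp => z dz; exists 1; first exact: spec1.
  rewrite scale1r; apply: (orthogonal_vanish nR aisleA Pres p'P _ _ _ nj dz).
  - by apply: orthogonal_koszul => // Q Qres f; exact: Vorth.
  - exact: qc_koszul.
  - by apply: s'_null => a as'; apply: null_mul_koszul; rewrite mem_cat as'.
(* The generators of [p'] are stripped one at a time. The remaining list still contains [x] and [s],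
   so a multiple of a power of [y], lying in the ideal of [x] and [p], acts as null there. *)
have descend j : n + (size (x :: s))%:Z <= j -> ~ supp p' (koszul (x :: s) V) j.
  elim: s' s'p {s'_null} vanish j => [|y s' IHs'] ys'p vanish j; first exact: vanish.
  apply: IHs' => [a as'|{}j]; first by apply: ys'p; rewrite inE as' orbT.
  have yp' : y \in p' by apply: ys'p; rewrite mem_head.
  apply: supp_cone_nil => [|{}j nj]; last by apply: vanish; rewrite /=; lia.
  have [t [m [r [c [tp' cp tE]]]]] := maximal_under_radical nR pmax xp' xp yp'.
  exists t, m; split; rewrite // tE; apply: null_mul_comb.
    by apply: null_mul_koszul; rewrite mem_cat mem_head orbT.
  apply: s_null cp => a a_s; apply: null_mul_koszul.
  by rewrite mem_cat inE a_s !orbT.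
have [c [dc _ cp]] := strict_ass_koszul sp Vass.
(* The bound for [x :: s] is exactly the degree [n + 1] of the class in [V], shifted by the cones
   over [s]; removing [x] by Nakayama keeps the degree. *)
have nq : ~ supp p' (koszul s V) (n + 1 + (size s)%:Z).
  apply: (supp_cone_surj ((qc_koszul s nR Vqc).1 _) xp'); apply: descend.
  by rewrite /=; lia.
(* Some [t] outside [p'] kills the class, whose annihilator is inside [p] and hence inside [p']. *)
have [t tp' /cp/pp'] := (not_supp _ _ _).1 nq c dc.
exact/negP.
Qed.
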